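(* Let $\Omega\subset\mathbb{R}^d$ be a bounded Lipschitz domain. Let $u\in L^2_{loc}(\mathbb{R}^d)$ be such that $u\in H^{s_0}(Q_\Omega)$ for some $s_0\in(0,1)$. Assume that $\alpha(u^+),\alpha(u^-),\alpha(u^2)$ exist and are finite. Then $$\lim_{s\to 0^+}\frac{s}{2}[u]^2_{H^s(Q_\Omega)}=\sum_{k=0}^{2}\binom{2}{k}(-1)^k\,\alpha(u^k)\int_\Omega u^{2-k}(x)\,dx .$$
   Context: $Q_\Omega=(\mathbb{R}^d\times\mathbb{R}^d)\setminus(\Omega^c\times\Omega^c)$, where $\Omega^c=\mathbb{R}^d\setminus\Omega$. For $s\in(0,1)$, $$[u]^2_{H^s(Q_\Omega)}=\iint_{Q_\Omega}\frac{|u(x)-u(y)|^2}{|x-y|^{d+2s}}\,dx\,dy,$$ and $u\in H^{s}(Q_\Omega)$ means that $u:\mathbb{R}^d\to\mathbb{R}$ is measurable, $u\in L^2(\Omega)$ and $[u]_{H^s(Q_\Omega)}<+\infty$. For a measurable function $w:\mathbb{R}^d\to\mathbb{R}$, its mass at infinity is $$\alpha(w)=\alpha_2(w):=\lim_{s\to0^+}s\int_{B_1^c(0)}\frac{w(y)}{|y|^{d+2s}}\,dy,$$ whenever this quantity is well defined; here $B_1^c(0)=\{y\in\mathbb{R}^d: |y|\ge 1\}$. In particular $u^0=1$ and $\alpha(1)=d\omega_d/2$, where $\omega_d$ is the Lebesgue measure of the unit ball of $\mathbb{R}^d$. Also $u^+=\max\{u,0\}$, $u^-=\max\{-u,0\}$.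 *)

(* Defs.v *)
From HB Require Import structures.
From mathcomp Require Import all_boot all_order all_algebra.
From mathcomp Require Import all_classical all_reals all_analysis.

Set Implicit Arguments.
Unset Strict Implicit.
Unset Printing Implicit Defensive.

Import Order.TTheory GRing.Theory Num.Theory.
Import numFieldNormedType.Exports.

Local Open Scope classical_set_scope.
Local Open Scope ring_scope.

(* As for tuples in the library, 'rV[R]_n carries the product of the Borel
   sigma-algebras of the coordinates. *)
Section borel_rV.
Context {R : realType}.
Variable n : nat.

Definition rV_coord (i : 'I_n) (x : 'rV[R]_n) : measurableTypeR R := x 0 i.

Let rV_set0 : g_sigma_preimage rV_coord set0.
Proof. exact: sigma_algebra0. Qed.

Let rV_setC A : g_sigma_preimage rV_coord A -> g_sigma_preimage rV_coord (~` A).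
Proof. exact: sigma_algebraC. Qed.

Let rV_bigcup (F : _^nat) : (forall i, g_sigma_preimage rV_coord (F i)) ->
  g_sigma_preimage rV_coord (\bigcup_i (F i)).
Proof. exact: sigma_algebra_bigcup. Qed.

HB.instance Definition _ := @isMeasurable.Build default_measure_display
  'rV[R]_n (g_sigma_preimage rV_coord) rV_set0 rV_setC rV_bigcup.

Lemma measurable_rV_coord (i : 'I_n) : measurable_fun [set: 'rV[R]_n] (rV_coord i).
Proof.
move=> _ Y mY; rewrite setTI; apply: sub_sigma_algebra => /=.
rewrite -bigcup_seq/=; exists i => /=; first by rewrite mem_index_enum.
by exists Y => //; rewrite setTI.
Qed.

Lemma measurable_fun_rV d (T : measurableType d) (f : T -> 'rV[R]_n) :
  (forall i, measurable_fun [set: T] (rV_coord i \o f)) -> measurable_fun [set: T] f.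
Proof.
move=> mf; apply: (@measurability _ _ _ _ _ _
  (\big[setU/set0]_(i < n) preimage_set_system setT (rV_coord i) measurable)) => //.
move=> _ [A + <-]; rewrite -bigcup_seq/= => -[i _ [B mB <-]].
by rewrite !setTI -comp_preimage -[X in measurable X]setTI; exact: mf.
Qed.

End borel_rV.

Section rV_cons.
Context {R : realType}.
Variable n : nat.

Definition rV_cons (p : measurableTypeR R * 'rV[R]_n) : 'rV[R]_n.+1 :=
  row_mx p.1%:M p.2.

Definition rV_uncons (x : 'rV[R]_n.+1) : measurableTypeR R * 'rV[R]_n :=
  (lsubmx (x : 'rV[R]_(1 + n)) 0 0, rsubmx (x : 'rV[R]_(1 + n))).

Lemma rV_consK : cancel rV_cons rV_uncons.
Proof.
by case=> a x; rewrite /rV_cons /rV_uncons/= row_mxKl row_mxKr !mxE mulr1n.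
Qed.

Lemma rV_unconsK : cancel rV_uncons rV_cons.
Proof.
move=> x; rewrite /rV_cons /rV_uncons/=.
set y : 'rV[R]_(1 + n) := x; rewrite (_ : (_%:M)%R = lsubmx y) ?hsubmxK//.
by apply/rowP => i; rewrite !ord1 [LHS]mxE.
Qed.

Lemma measurable_rV_cons : measurable_fun [set: _] rV_cons.
Proof.
apply: measurable_fun_rV => i.
have := splitK (i : 'I_(1 + n)); case: fintype.splitP => j ij _.
  rewrite (_ : _ \o _ = fst) //; apply/funext => -[a x] /=.
  rewrite /rV_coord /rV_cons (_ : i = @lshift 1 n j); last exact: val_inj.
  by rewrite mxE !ord1 (unsplitK (inl 0)) mxE eqxx mulr1n.
rewrite (_ : _ \o _ = rV_coord j \o snd).
  by apply: measurableT_comp => //; exact: measurable_rV_coord.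
apply/funext => -[a x] /=.
rewrite /rV_coord /rV_cons (_ : i = @rshift 1 n j); last exact: val_inj.
by rewrite mxE (unsplitK (inr j)).
Qed.

Lemma measurable_rV_uncons : measurable_fun [set: _] rV_uncons.
Proof.
apply/measurable_fun_pairP; split => /=.
  rewrite (_ : _ \o _ = rV_coord (@lshift 1 n 0)); last first.
    by apply/funext => x; rewrite /= mxE.
  exact: measurable_rV_coord.
apply: measurable_fun_rV => i.
rewrite (_ : _ \o _ = rV_coord (@rshift 1 n i)); last first.
  by apply/funext => x; rewrite /= /rV_coord mxE.
exact: measurable_rV_coord.
Qed.

End rV_cons.

Local Open Scope ereal_scope.

Section lebesgue_rV_cons.
Context {R : realType}.
Variables (n : nat) (m : {sigma_finite_measure set 'rV[R]_n -> \bar R}).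

Definition lebesgue_cons : set 'rV[R]_n.+1 -> \bar R :=
  pushforward (lebesgue_measure \x m) (@rV_cons R n).

Let prod_measure : {measure set (measurableTypeR R * 'rV[R]_n)%type -> \bar R} :=
  lebesgue_measure \x m.

HB.instance Definition _ := Measure.copy lebesgue_cons
  (measure_function_pushforward__canonical__measure_function_Measure
    prod_measure (@measurable_rV_cons R n)).

Let lebesgue_cons_sigma_finite : sigma_finite setT lebesgue_cons.
Proof.
have /sigma_finiteP[F [TF ndF Foo]] := sigma_finiteT (@lebesgue_measure R).
have /sigma_finiteP[G [TG ndG Goo]] := sigma_finiteT m.
exists (fun k => @rV_uncons R n @^-1` (F k `*` G k)).
  rewrite -preimage_bigcup (_ : \bigcup_k _ = setT) ?preimage_setT//.
  rewrite -subTset => -[x y] _.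
  have [i _ Fix] : (\bigcup_k F k) x by rewrite -TF.
  have [j _ Gjy] : (\bigcup_k G k) y by rewrite -TG.
  exists (maxn i j) => //; split => /=.
    by move: x Fix; exact/subsetPset/ndF/leq_maxl.
  by move: y Gjy; exact/subsetPset/ndG/leq_maxr.
move=> k; have [mF Fk] := Foo k; have [mG Gk] := Goo k; split.
  by rewrite -[X in measurable X]setTI; apply: measurable_rV_uncons => //;
    exact: measurableX.
rewrite /= /lebesgue_cons /pushforward -comp_preimage.
rewrite (_ : _ \o _ = id) ?preimage_id; last by apply/funext; exact: rV_consK.
by rewrite product_measure1E// lte_mul_pinfty// ge0_fin_numE.
Qed.

HB.instance Definition _ := Measure_isSigmaFinite.Build _ _ _ lebesgue_cons
  lebesgue_cons_sigma_finite.

End lebesgue_rV_cons.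

(* The n-fold product of the one-dimensional Lebesgue measure. *)
Fixpoint borel_lebesgue {R : realType} (n : nat) :
    {sigma_finite_measure set 'rV[R]_n -> \bar R} :=
  if n is n'.+1 then lebesgue_cons (borel_lebesgue n') else \d_(0%R : 'rV[R]_0).

Section lebesgue_rV.
Variables (R : realType) (d : nat).

(* 'rV[R]_d with the sigma-algebra of Lebesgue measurable sets, obtained like
   the library's completed_lebesgue_measure. *)
Definition Rd := caratheodory_type ((@borel_lebesgue R d)^*)%mu.

Definition lebesgue_rV : set Rd -> \bar R :=
  @completed_measure_extension _ _ _ (@borel_lebesgue R d).

HB.instance Definition _ := Measure.on lebesgue_rV.

Let lebesgue_rV_sigma_finite : sigma_finite setT lebesgue_rV.
Proof. exact/completed_measure_extension_sigma_finite/sigma_finiteT. Qed.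

HB.instance Definition _ := Measure_isSigmaFinite.Build _ _ _ lebesgue_rV
  lebesgue_rV_sigma_finite.

End lebesgue_rV.

Arguments lebesgue_rV : clear implicits.

Section box_measure.
Context {R : realType}.

Definition box n (a b : 'I_n -> R) : set 'rV[R]_n :=
  [set x | forall i, (a i < x 0 i <= b i)%R].

Lemma measurable_box n (a b : 'I_n -> R) : measurable (box a b).
Proof.
rewrite (_ : box a b = \big[setI/setT]_(i < n) (rV_coord i @^-1` `]a i, b i])).
  apply: bigsetI_measurable => i _; rewrite -[X in measurable X]setTI.
  exact: measurable_rV_coord.
rewrite -bigcap_seq; apply/seteqP; split => x xab i.
  by move=> _; rewrite /rV_coord /= in_itv; exact: xab.
by have := xab i (mem_index_enum _); rewrite /rV_coord /= in_itv.
Qed.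

Lemma borel_lebesgue_box n (a b : 'I_n -> R) : (forall i, a i <= b i)%R ->
  borel_lebesgue n (box a b) = (\prod_(i < n) (b i - a i))%:E.
Proof.
elim: n a b => [|n IH] a b ab.
  by rewrite big_ord0 /= diracE mem_set// => -[].
rewrite /= /lebesgue_cons /pushforward big_ord_recl.
rewrite (_ : _ @^-1` _ =
    `]a ord0, b ord0] `*` box (a \o lift ord0) (b \o lift ord0)).
  rewrite product_measure1E//; last exact: measurable_box.
  rewrite IH//= EFinM; congr (_ * _).
  rewrite -[LHS]/(lebesgue_measure `]a ord0, b ord0]) lebesgue_measure_itv/= lte_fin.
  by case: ltgtP (ab ord0) => //= ->; rewrite subrr.
have E0 (p : measurableTypeR R * 'rV[R]_n) : (rV_cons p) 0%R ord0 = p.1.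
  rewrite (_ : ord0 = @lshift 1 n ord0); last exact: val_inj.
  by rewrite mxE (unsplitK (inl ord0)) mxE eqxx mulr1n.
have E1 (p : measurableTypeR R * 'rV[R]_n) j :
    (rV_cons p) 0%R (lift ord0 j) = p.2 0%R j.
  rewrite (_ : lift ord0 j = @rshift 1 n j); last exact: val_inj.
  by rewrite mxE (unsplitK (inr j)).
apply/seteqP; split => [p xab|p [/=]].
  split => /=; first by rewrite in_itv/= -(E0 p); exact: xab.
  by move=> j /=; rewrite -E1; exact: xab.
rewrite in_itv/= -(E0 p) => p1 p2 i.
have [j ->|->//] := unliftP ord0 i.
by rewrite E1; exact: p2.
Qed.

Lemma lebesgue_rV_box n (a b : 'I_n -> R) : (forall i, a i <= b i)%R ->
  lebesgue_rV R n (box a b) = (\prod_(i < n) (b i - a i))%:E.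
Proof.
move=> ab; rewrite -borel_lebesgue_box//.
by apply: measurable_mu_extE; exact: measurable_box.
Qed.

End box_measure.

Section fractional_seminorm.
Context {R : realType} {d : nat}.
Implicit Types (Om : set 'rV[R]_d) (u w : 'rV[R]_d -> R) (s : R).

Local Notation mu := (lebesgue_rV R d).

(* The library norm on 'rV[R]_d is the sup norm. *)
Definition enorm (x : 'rV[R]_d) : R := Num.sqrt (\sum_(i < d) x 0 i ^+ 2)%R.

Definition domain Om := [/\ Om !=set0, open Om & connected Om].

(* Lipschitz maps and bounded sets are the same for the sup and Euclidean norms.
   Near each boundary point, after an orthogonal change of coordinates, Om is
   the strict epigraph, in some coordinate direction i, of a Lipschitz function
   of the d.-1 other coordinates. *)
Definition lipschitz_boundary Om := forall x, (closure Om `\` Om°) x ->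
  exists (r : R) (Q : 'M[R]_d) (i : 'I_d) (g : 'rV[R]_d.-1 -> R),
    [/\ (0 < r)%R, (Q *m Q^T = 1%:M)%R, lipschitz (g : _ -> R^o) &
        forall y, (enorm (y - x) < r)%R ->
          Om y <-> (g (col' i (y *m Q)) < (y *m Q)%R 0%R i)%R].

Definition bounded_lipschitz_domain Om :=
  [/\ domain Om, bounded_set Om & lipschitz_boundary Om].

Definition lebesgue_measurable_fun (A : set 'rV[R]_d) u :=
  measurable_fun (A : set (Rd R d)) (u : Rd R d -> R).

Definition L2 (A : set 'rV[R]_d) u :=
  lebesgue_measurable_fun A u /\ \int[mu]_(x in A) (`|u x| ^+ 2)%:E < +oo.

Definition L2loc u :=
  lebesgue_measurable_fun setT u /\ forall K, compact K -> L2 K u.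

Definition Qset Om : set (Rd R d * Rd R d) := ~` (~` Om `*` ~` Om).

(* On the diagonal, which is a null set, the integrand reads 0 / 0 = 0. *)
Definition Hs_seminorm_sq s Om u : \bar R :=
  \int[mu \x mu]_(p in Qset Om)
    (`|u p.1 - u p.2| ^+ 2 / enorm (p.1 - p.2) `^ (d%:R + 2 * s))%:E.

Definition Hs s Om u :=
  [/\ lebesgue_measurable_fun setT u, L2 Om u & Hs_seminorm_sq s Om u < +oo].

(* mass_approx w s is the quantity whose limit as s -> 0+ is alpha w. *)
Definition mass_approx w s : \bar R :=
  s%:E * \int[mu]_(y in [set y | (1 <= enorm y)%R])
           (w y / enorm y `^ (d%:R + 2 * s))%:E.

Definition alpha w : \bar R := lim (mass_approx w s @[s --> 0^'+]).

Definition alpha_exists_finite w :=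
  cvg (mass_approx w s @[s --> 0^'+]) /\ alpha w \is a fin_num.

End fractional_seminorm.

(* Main.v *)
Require Import Defs.
From HB Require Import structures.
From mathcomp Require Import all_boot all_order all_algebra.
From mathcomp Require Import all_classical all_reals all_analysis.
From mathcomp Require Import measurable_realfun ring lra.

Set Implicit Arguments.
Unset Strict Implicit.
Unset Printing Implicit Defensive.

Import Order.TTheory GRing.Theory Num.Theory.
Import numFieldNormedType.Exports.

Local Open Scope classical_set_scope.
Local Open Scope ring_scope.
Local Open Scope ereal_scope.

(** Write [Q] for [Qset Om] and suppose that [Om] lies in the ball of radius
    [rho]. For small [s] the factor [s] kills every contribution to the seminorm
    except that of pairs with one point in [Om] and the other one very far away;
    for such a pair the distance is essentially the norm of the far point, and
    the integral splits.

    Fix [lam] in [(0, 1)] and put [M = rho / lam]. Remove from [Q] the two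
    rectangles of pairs with one point in [Om] and the other one of norm at least
    [M]. The remaining pairs are at distance at most [2 M], where the kernel for
    [s] is at most a constant times the kernel for [s0]; so their contribution is
    at most [s] times a constant (lemma [near_pairs_le]). The two rectangles are
    exchanged by symmetry. On the one with [x] in [Om] and [|y| >= M], the quotient
    [|x - y| / |y|] lies between [1 - lam] and [1 + lam], so up to a factor that
    tends to [1] with [lam] the kernel may be replaced by the power
    [weight s y = |y| ^ - (d + 2 s)] (lemma [far_pairs_itv]).
    After that, expanding [(u x - u y) ^ 2] separates the variables (lemma
    [integral_square_diff]): what is left is a combination of the integrals of
    [1], [u] and [u ^ 2] over [Om], whose coefficients are [s] times the integral
    of [u y ^ k * weight s y] over [|y| >= M]. These tend to [alpha (u ^ k)],
    since changing the radius of the removed ball from [1] to [M] only changes an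
    integral over a bounded set (lemma [has_mass_outer]). The limit does not depend
    on [lam], which may now tend to [0] (lemma [squeeze_cvge_factor]).

    The masses of [u ^ 2] and of the positive and negative parts of [u] exist by
    hypothesis, and that of [u] is the difference of the last two. That the mass of
    [1] exists and is finite needs a proof (lemma [cvg_mass_approx1]). Lebesgue
    measure scales by [2 ^ d] under [y |-> 2 y], so the integral [I s] of the weight over [|y| >= 1]
    satisfies [I s = J s + 4 ^ - s * I s], where [J s] is the integral over
    [1 <= |y| < 2]; hence [s * I s = J s * s / (1 - 4 ^ - s)], which tends to
    [J 0 / ln 4]. *)

(** * The Euclidean norm *)

Section euclidean_norm.
Context {R : realType} {d : nat}.
Implicit Types x y : 'rV[R]_d.
Local Open Scope ring_scope.

Lemma enorm_ge0 x : 0 <= enorm x.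
Proof. exact: sqrtr_ge0. Qed.

Lemma sqr_enorm x : enorm x ^+ 2 = \sum_(i < d) x 0 i ^+ 2.
Proof. by rewrite sqr_sqrtr// sumr_ge0// => i _; rewrite sqr_ge0. Qed.

Lemma enormN x : enorm (- x) = enorm x.
Proof. by congr Num.sqrt; apply: eq_bigr => i _; rewrite mxE sqrrN. Qed.

Lemma enorm_distC x y : enorm (x - y) = enorm (y - x).
Proof. by rewrite -enormN opprB. Qed.

Lemma enormZ (a : R) x : 0 <= a -> enorm (a *: x) = a * enorm x.
Proof.
move=> a0; rewrite /enorm -[in RHS](ger0_norm a0) -sqrtr_sqr -sqrtrM ?sqr_ge0//.
by rewrite mulr_sumr; congr Num.sqrt; apply: eq_bigr => i _; rewrite mxE exprMn.
Qed.

Lemma ler_coord_enorm x i : `|x 0 i| <= enorm x.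
Proof.
rewrite -sqrtr_sqr ler_wsqrtr// (bigD1 i)//= lerDl.
by rewrite sumr_ge0// => j _; rewrite sqr_ge0.
Qed.

(** Expanding the sum of the squares of [b x_i - a y_i], with [a] and [b] the
    norms of [x] and [y], gives [0 <= 2 a b (a b - <x, y>)]. *)
Lemma enorm_cauchy_schwarz x y :
  \sum_(i < d) x 0 i * y 0 i <= enorm x * enorm y.
Proof.
have [xy0|xy_neq0] := eqVneq (enorm x * enorm y) 0.
  rewrite xy0 big1// => i _; apply/eqP; rewrite -normr_eq0 normrM.
  by rewrite eq_le mulr_ge0// andbT -xy0 ler_pM// ler_coord_enorm.
have xy_gt0 : 0 < enorm x * enorm y by rewrite lt0r xy_neq0 mulr_ge0 ?enorm_ge0.
rewrite -(ler_pM2l xy_gt0) -subr_ge0 -(@pmulr_rge0 _ 2)//.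
have : 0 <= \sum_(i < d) (enorm y * x 0 i - enorm x * y 0 i) ^+ 2.
  by rewrite sumr_ge0// => i _; rewrite sqr_ge0.
rewrite (eq_bigr (fun i => enorm y ^+ 2 * x 0 i ^+ 2 + enorm x ^+ 2 * y 0 i ^+ 2
  - 2 * (enorm x * enorm y) * (x 0 i * y 0 i))); last by move=> i _; ring.
rewrite sumrB big_split/= -!mulr_sumr -!sqr_enorm.
by set S := \sum_(_ < _) _; congr (_ <= _); ring.
Qed.

Lemma ler_enormD x y : enorm (x + y) <= enorm x + enorm y.
Proof.
rewrite -(@ler_pXn2r _ 2) ?nnegrE ?enorm_ge0 ?addr_ge0 ?enorm_ge0//.
rewrite sqrrD !sqr_enorm.
under eq_bigr do rewrite mxE sqrrD.
rewrite !big_split/= lerD2r lerD2l -mulr2n ler_wMn2r//.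
exact: enorm_cauchy_schwarz.
Qed.

Lemma ler_enorm_norm x : enorm x <= d%:R * `|x|.
Proof.
have x1 i : `|x 0 i| <= `|x|.
  rewrite [leRHS]/Num.norm/= mx_normrE.
  by apply/bigmax_geP; right; exists (0, i).
apply: (@le_trans _ _ (\sum_(i < d) `|x 0 i|)); last first.
  rewrite (le_trans (ler_sum _ (fun i _ => x1 i)))// sumr_const card_ord.
  by rewrite mulr_natl.
rewrite -(@ler_pXn2r _ 2) ?nnegrE ?enorm_ge0 ?sumr_ge0//.
rewrite sqr_enorm expr2 mulr_suml ler_sum// => i _.
rewrite -(real_normK (num_real _)) expr2 ler_wpM2l// (bigD1 i)//= lerDl.
by rewrite sumr_ge0.
Qed.

End euclidean_norm.

(** * Borel and Lebesgue measurable sets *)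

Section borel_sets.
Context {R : realType} {d : nat}.

Lemma measurable_Rd (A : set 'rV[R]_d) :
  measurable A -> measurable (A : set (Rd R d)).
Proof.
by move=> mA; apply: sub_caratheodory; exact: sub_sigma_algebra.
Qed.

Lemma measurable_fun_Rd d' (T : measurableType d') (f : 'rV[R]_d -> T) :
  measurable_fun setT f -> measurable_fun setT (f : Rd R d -> T).
Proof.
move=> mf _ Y mY; rewrite setTI; apply: measurable_Rd.
by rewrite -[X in measurable X]setTI; exact: mf.
Qed.

Lemma measurable_ball_rV (x : 'rV[R]_d) (e : R) : measurable (ball x e).
Proof.
have [e0|e0] := ltP 0%R e; last first.
  rewrite (_ : ball x e = set0)// -subset0 => y -[e_gt0 _].
  by have := le_lt_trans e0 e_gt0; rewrite ltxx.
rewrite (_ : ball x e =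
    \big[setI/setT]_(i < d) (rV_coord i @^-1` ball (x ord0 i) e)).
  apply: bigsetI_measurable => i _; rewrite -[X in measurable X]setTI.
  by apply: measurable_rV_coord => //; exact: measurable_ball.
rewrite -bigcap_seq; apply/seteqP; split => [y [_ xy] i _|y xy]; first exact: xy.
by split => // i j; rewrite ord1; apply: (xy j); rewrite /= mem_index_enum.
Qed.

(** An open set is the union of the open cubes with a rational centre and a
    radius [1 / k.+1] that it contains, and there are countably many of them. *)
Lemma open_measurable_rV (A : set 'rV[R]_d) : open A -> measurable A.
Proof.
move=> oA; pose c (q : 'rV[rat]_d) : 'rV[R]_d := map_mx ratr q.
pose B (p : 'rV[rat]_d * nat) : set 'rV[R]_d := ball (c p.1) (p.2.+1%:R^-1)%R.
pose D p : set 'rV[R]_d := if `[< B p `<=` A >] then B p else set0.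
have -> : A = \bigcup_p D p.
  apply/seteqP; split => [x Ax|x [p _]]; last first.
    by rewrite /D; case: ifPn => // /asboolP BA /BA.
  have /nbhs_ballP[e e0 xeA] : nbhs x A by exact: open_nbhs_nbhs.
  have [k ke] : exists k, (k.+1%:R^-1 < e / 2)%R.
    have e20 : (0 < e / 2)%R by rewrite divr_gt0.
    have [k _ /(_ _ (leqnn k)) ke] := near_infty_natSinv_lt (PosNum e20).
    by exists k.
  have k0 : (0 < k.+1%:R^-1 :> R)%R by rewrite invr_gt0.
  have /choice[q xq] : forall i, exists q : rat,
      ball (x ord0 i) (k.+1%:R^-1)%R (ratr q : R).
    move=> i; have xx : (x ord0 i - k.+1%:R^-1 < x ord0 i)%R.
      by rewrite ltrBlDr ltrDl.
    have [q] := rat_in_itvoo xx; rewrite in_itv/= => /andP[q1 q2]; exists q.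
    by rewrite /ball/= gtr0_norm ?subr_gt0// ltrBlDr -ltrBlDl.
  have cx : ball (c (\row_i q i)) (k.+1%:R^-1)%R x.
    by split => // i j; rewrite ord1 !mxE; apply: ball_sym; exact: xq.
  exists (\row_i q i, k) => //; rewrite /D asboolT// => y cy.
  apply: xeA; rewrite [e]splitr; apply: ball_triangle.
    by apply: le_ball (ball_sym cx); exact: ltW.
  by apply: le_ball cy; exact: ltW.
apply: countable_bigcupT_measurable; first exact: countableP.
by move=> p; rewrite /D; case: ifPn => // _; exact: measurable_ball_rV.
Qed.

Lemma measurable_sqrtr : measurable_fun setT (@Num.sqrt R).
Proof. by apply: continuous_measurable_fun; exact: sqrt_continuous. Qed.

Lemma measurable_enorm : measurable_fun setT (@enorm R d).
Proof.
apply: measurableT_comp; first exact: measurable_sqrtr.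
by apply: measurable_sum => i; apply: measurable_funX; exact: measurable_rV_coord.
Qed.

Lemma measurable_enorm_le (r : R) :
  measurable ([set y | (enorm y <= r)%R] : set (Rd R d)).
Proof.
apply: measurable_Rd; rewrite -[X in measurable X]setTI.
by apply: measurable_fun_ler => //; exact: measurable_enorm.
Qed.

Lemma measurable_enorm_ge (r : R) :
  measurable ([set y | (r <= enorm y)%R] : set (Rd R d)).
Proof.
apply: measurable_Rd; rewrite -[X in measurable X]setTI.
by apply: measurable_fun_ler => //; exact: measurable_enorm.
Qed.

Lemma measurable_enorm_dist :
  measurable_fun setT (fun p : Rd R d * Rd R d => enorm (p.1 - p.2)%R).
Proof.
apply: (measurableT_comp measurable_sqrtr).
apply: measurable_sum => i; apply: measurable_funX.
have mi : measurable_fun setT (rV_coord i : Rd R d -> R).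
  by apply: measurable_fun_Rd; exact: measurable_rV_coord.
rewrite (_ : (fun _ => _) = (rV_coord i \o (fst : Rd R d * Rd R d -> Rd R d)) \-
    (rV_coord i \o (snd : Rd R d * Rd R d -> Rd R d)))%R.
  by apply: measurable_funB; [apply: (measurableT_comp mi)|apply: (measurableT_comp mi)].
by apply/funext => p; rewrite !mxE.
Qed.

Lemma lebesgue_rV_ball_lty (r : R) : (0 <= r)%R ->
  lebesgue_rV R d [set y | (enorm y <= r)%R] < +oo.
Proof.
move=> r0; pose a (_ : 'I_d) := (- (r + 1))%R; pose b (_ : 'I_d) := (r + 1)%R.
have ab i : (a i <= b i)%R by rewrite /a /b; lra.
apply: (@le_lt_trans _ _ (lebesgue_rV R d (box a b))).
  apply: le_measure; rewrite ?inE.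
  - exact: measurable_enorm_le.
  - by apply: measurable_Rd; exact: measurable_box.
  - move=> y /= yr i; have := le_trans (ler_coord_enorm y i) yr.
    by rewrite ler_norml /a /b => /andP[? ?]; lra.
by rewrite lebesgue_rV_box// ltry.
Qed.

End borel_sets.

(** * Lebesgue measure under dilations *)

Lemma ge0_integral_comp_scale d (T : measurableType d) (R : realType)
    (mu : {measure set T -> \bar R}) (g : T -> T) (k : {nonneg R})
    (D : set T) (f : T -> \bar R) :
  measurable_fun setT g ->
  (forall A, measurable A -> mu (g @^-1` A) = k%:num%:E * mu A) ->
  measurable D -> measurable_fun D f -> (forall x, D x -> 0 <= f x) ->
  \int[mu]_(x in g @^-1` D) f (g x) = k%:num%:E * \int[mu]_(x in D) f x.
Proof.
move=> mg muE mD mf f0; rewrite -ge0_integral_mscale//.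
rewrite -[LHS](ge0_integral_pushforward mg mu mD mf); last first.
  by move=> x; rewrite inE; exact: f0.
by apply: eq_measure_integral => A mA _; exact: muE.
Qed.

Lemma measurable_scale_rV (R : realType) d (c : R) :
  measurable_fun setT ( *:%R c : 'rV[R]_d -> 'rV[R]_d).
Proof.
apply: measurable_fun_rV => j.
rewrite (_ : _ \o _ = (cst c \* rV_coord j)%R).
  by apply: measurable_funM => //; exact: measurable_rV_coord.
by apply/funext => x; rewrite /rV_coord/= mxE.
Qed.

Section scaling.
Context {R : realType}.
Variables (c : R) (c0 : (0 < c)%R).

Let scaleR : measurableTypeR R -> measurableTypeR R := fun x => (c * x)%R.

Let measurable_scaleR : measurable_fun setT scaleR.
Proof. exact: (@measurable_funM _ _ _ _ (cst c) id). Qed.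

Let nnc : {nonneg R} := NngNum (ltW c0).

Lemma lebesgue_measure_scale (A : set (measurableTypeR R)) : measurable A ->
  lebesgue_measure (scaleR @^-1` A) = c^-1%:E * lebesgue_measure A.
Proof.
move=> mA.
pose m : {measure set (measurableTypeR R) -> \bar R} :=
  measure_function_pushforward__canonical__measure_function_Measure
    lebesgue_measure measurable_scaleR.
suff -> : lebesgue_measure A = mscale nnc m A.
  by rewrite /mscale/= muleA -EFinM mulVf ?gt_eqF// mul1e.
apply: lebesgue_measure_unique => //= _ [[a b] _ <-].
rewrite /mscale/= /pushforward.
have -> : scaleR @^-1` `]a, b] = `](c^-1 * a)%R, (c^-1 * b)%R]%classic.
  by apply/seteqP; split => x /=; rewrite !in_itv/= /scaleR !(ler_pdivlMl, ltr_pdivrMl).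
rewrite !lebesgue_measure_itv/= !lte_fin ltr_pM2l ?invr_gt0//.
case: ifPn => _; last by rewrite mule0.
by rewrite -!EFinD -EFinM -mulrBr mulrA divff ?gt_eqF// mul1r.
Qed.

Lemma ge0_integral_scaleR (f : R -> \bar R) :
  measurable_fun setT f -> (forall x, 0 <= f x) ->
  \int[lebesgue_measure]_x f (c * x)%R = c^-1%:E * \int[lebesgue_measure]_x f x.
Proof.
move=> mf f0.
have cV0 : (0 <= c^-1)%R by rewrite invr_ge0 ltW.
by rewrite -(@ge0_integral_comp_scale _ _ _ lebesgue_measure scaleR (NngNum cV0)
  setT)//; exact: lebesgue_measure_scale.
Qed.

Lemma scale_rV_cons n (p : measurableTypeR R * 'rV[R]_n) :
  (c *: rV_cons p = rV_cons (c * p.1, c *: p.2))%R.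
Proof.
apply/rowP => j; rewrite [LHS]mxE [in LHS]mxE [RHS]mxE /=.
by case: fintype.split => k; rewrite !mxE ?mulrnAr.
Qed.

(** By induction on the dimension: the section of the scaled set at [x] is the
    scaled section at [c x], so one dimension at a time contributes [c^-1]. *)
Lemma borel_lebesgue_scale n (A : set 'rV[R]_n) : measurable A ->
  borel_lebesgue n (( *:%R c) @^-1` A) = (c^-1 ^+ n)%:E * borel_lebesgue n A.
Proof.
elim: n A => [|n IH] A mA.
  rewrite expr0 mul1e/= !diracE; congr (_%:R%:E); apply: congr1.
  by apply/idP/idP; rewrite !inE/= scaler0.
have mcA : measurable (@rV_cons R n @^-1` A).
  by rewrite -[X in measurable X]setTI; exact: measurable_rV_cons.
rewrite /= /lebesgue_cons /pushforward/=.
rewrite /product_measure1/=.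
pose F (x : measurableTypeR R) := borel_lebesgue n (xsection (@rV_cons R n @^-1` A) x).
have mF : measurable_fun setT F by exact: measurable_fun_xsection.
have cV0 : (0 <= c^-1)%R by rewrite invr_ge0 ltW.
transitivity (\int[lebesgue_measure]_x ((c^-1 ^+ n)%:E * F (c * x)%R)).
  apply: eq_integral => x _; rewrite /F -IH; last exact: measurable_xsection.
  congr (borel_lebesgue n _); apply/seteqP.
  by split=> v; rewrite /= /xsection/= !inE/= scale_rV_cons.
have F0 x : 0 <= F x by [].
rewrite ge0_integralZl; [|by []|exact: measurableT_comp|by []|by rewrite lee_fin exprn_ge0].
by rewrite ge0_integral_scaleR// muleA -EFinM -exprSr.
Qed.

(** Only Borel functions are covered: their integral is the integral with
    respect to [borel_lebesgue], where the previous lemma applies. *)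
Lemma ge0_integral_scale_rV d (D : set 'rV[R]_d) (f : 'rV[R]_d -> \bar R) :
  measurable D -> measurable_fun D f -> (forall x, D x -> 0 <= f x) ->
  \int[lebesgue_rV R d]_(x in ( *:%R c) @^-1` D) f (c *: x)%R =
  (c^-1 ^+ d)%:E * \int[lebesgue_rV R d]_(x in D) f x.
Proof.
move=> mD mf f0.
have muE (A : set 'rV[R]_d) : measurable A ->
    lebesgue_rV R d A = borel_lebesgue d A.
  by move=> mA; exact: measurable_mu_extE.
pose i : Rd R d -> 'rV[R]_d := id.
have mi : measurable_fun setT i := measurable_fun_Rd (@measurable_id _ _ setT).
have integralE (E : set 'rV[R]_d) (g : 'rV[R]_d -> \bar R) : measurable E ->
    measurable_fun E g -> (forall x, E x -> 0 <= g x) ->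
    \int[lebesgue_rV R d]_(x in E) g x = \int[borel_lebesgue d]_(x in E) g x.
  move=> mE mg g0.
  rewrite -[LHS](ge0_integral_pushforward mi (lebesgue_rV R d) mE mg); last first.
    by move=> x; rewrite inE; exact: g0.
  by apply: eq_measure_integral => A mA _; exact: muE.
have cV0 : (0 <= c^-1 ^+ d)%R by rewrite exprn_ge0// invr_ge0 ltW.
have mc := @measurable_scale_rV R d c.
rewrite !integralE//.
- apply: (@ge0_integral_comp_scale _ _ _ (borel_lebesgue d) _ (NngNum cV0)) => //.
  exact: borel_lebesgue_scale.
- by rewrite -[X in measurable X]setTI; exact: mc.
- apply: (@measurable_comp _ _ _ _ _ _ D) => //; last exact: measurable_funTS.
  by move=> _ [x Dx <-].
- by move=> x cDx; exact: f0.
Qed.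

End scaling.

(** * Integrals over products *)

Section tonelli.
Context {d1 d2 : measure_display} {T1 : measurableType d1} {T2 : measurableType d2}.
Context {R : realType}.
Variables (m1 : {sigma_finite_measure set T1 -> \bar R}).
Variables (m2 : {sigma_finite_measure set T2 -> \bar R}).
Variables (A : set T1) (B : set T2).
Hypotheses (mA : measurable A) (mB : measurable B).

Let patch_setX (f : T1 * T2 -> \bar R) x :
  (fun y => (f \_ (A `*` B)) (x, y)) = if x \in A then (fun y => f (x, y)) \_ B else cst 0.
Proof.
by apply/funext => y; rewrite /patch in_setX/=; case: (x \in A).
Qed.

Let patch_setX_swap (f : T1 * T2 -> \bar R) y :
  (fun x => (f \_ (A `*` B)) (x, y)) = if y \in B then (fun x => f (x, y)) \_ A else cst 0.
Proof.
by apply/funext => x; rewrite /patch in_setX/= andbC; case: (y \in B).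
Qed.

Let ge0_patch_setX (f : T1 * T2 -> \bar R) : (forall p, 0 <= f p) ->
  forall p, 0 <= (f \_ (A `*` B)) p.
Proof. by move=> f0 p; rewrite /patch; case: ifP. Qed.

Lemma ge0_integral_setX (f : T1 * T2 -> \bar R) :
  measurable_fun setT f -> (forall p, 0 <= f p) ->
  \int[m1 \x m2]_(p in A `*` B) f p = \int[m1]_(x in A) \int[m2]_(y in B) f (x, y).
Proof.
move=> mf f0; rewrite integral_mkcond fubini_tonelli1; last 2 first.
- apply/(measurable_restrictT f); first exact: measurableX.
  exact: measurable_funTS.
- exact: ge0_patch_setX.
rewrite [RHS]integral_mkcond; apply: eq_integral => x _.
rewrite /fubini_F patch_setX [RHS]/patch; case: ifP => _; last exact: integral0.
by rewrite -integral_mkcond.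
Qed.

Lemma ge0_integral_setX_swap (f : T1 * T2 -> \bar R) :
  measurable_fun setT f -> (forall p, 0 <= f p) ->
  \int[m1 \x m2]_(p in A `*` B) f p = \int[m2]_(y in B) \int[m1]_(x in A) f (x, y).
Proof.
move=> mf f0; rewrite integral_mkcond fubini_tonelli2; last 2 first.
- apply/(measurable_restrictT f); first exact: measurableX.
  exact: measurable_funTS.
- exact: ge0_patch_setX.
rewrite [RHS]integral_mkcond; apply: eq_integral => y _.
rewrite /fubini_G patch_setX_swap [RHS]/patch; case: ifP => _; last exact: integral0.
by rewrite -integral_mkcond.
Qed.

End tonelli.

(** Both sides are iterated integrals with the same outer variable, which is the
    first one on the left and the second one on the right. *)
Lemma ge0_integral_setX_sym d (T : measurableType d) (R : realType)
    (mu : {sigma_finite_measure set T -> \bar R}) (A B : set T) (f : T * T -> \bar R) :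
  measurable A -> measurable B -> measurable_fun setT f -> (forall p, 0 <= f p) ->
  (forall x y, f (x, y) = f (y, x)) ->
  \int[mu \x mu]_(p in B `*` A) f p = \int[mu \x mu]_(p in A `*` B) f p.
Proof.
move=> mA mB mf f0 fC.
rewrite (ge0_integral_setX mu mu mB mA mf f0).
rewrite (ge0_integral_setX_swap mu mu mA mB mf f0).
by apply: eq_integral => y _; apply: eq_integral => x _.
Qed.

Lemma integral_lincomb3 d (T : measurableType d) (R : realType)
    (mu : {measure set T -> \bar R}) (D : set T) (f g h : T -> R) (a b c : R) :
  measurable D -> mu.-integrable D (EFin \o f) -> mu.-integrable D (EFin \o g) ->
  mu.-integrable D (EFin \o h) ->
  \int[mu]_(x in D) (a * f x + (b * g x + c * h x))%:E =
  (a * (\int[mu]_(x in D) f x) +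
   (b * (\int[mu]_(x in D) g x) + c * (\int[mu]_(x in D) h x)))%R%:E.
Proof.
move=> mD fi gi hi.
have scale (r : R) (e : T -> R) : mu.-integrable D (EFin \o e) ->
    mu.-integrable D (EFin \o (fun x => r * e x)%R).
  by move=> ei; exact: (integrableZl mD r ei).
have add (e1 e2 : T -> R) : mu.-integrable D (EFin \o e1) ->
    mu.-integrable D (EFin \o e2) -> mu.-integrable D (EFin \o (fun x => e1 x + e2 x)%R).
  by move=> e1i e2i; exact: (integrableD mD e1i e2i).
have fgh := add _ _ (scale a f fi) (add _ _ (scale b g gi) (scale c h hi)).
rewrite -[LHS]fineK; last exact: integrable_fin_num.
congr EFin; transitivity (\int[mu]_(x in D) (a * f x + (b * g x + c * h x)))%R => //.
rewrite (RintegralD mD (scale a f fi) (add _ _ (scale b g gi) (scale c h hi))).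
by rewrite (RintegralD mD (scale b g gi) (scale c h hi)) !RintegralZl.
Qed.

(** Expanding the square, the two variables separate. *)
Lemma integral_square_diff d (T : measurableType d) (R : realType)
    (mu : {measure set T -> \bar R}) (A B : set T) (u k : T -> R) :
  measurable A -> measurable B ->
  mu.-integrable A (EFin \o cst 1%R) -> mu.-integrable A (EFin \o u) ->
  mu.-integrable A (EFin \o (fun x => u x ^+ 2)%R) ->
  mu.-integrable B (EFin \o (fun y => 1 * k y)%R) ->
  mu.-integrable B (EFin \o (fun y => u y * k y)%R) ->
  mu.-integrable B (EFin \o (fun y => u y ^+ 2 * k y)%R) ->
  \int[mu]_(x in A) \int[mu]_(y in B) ((u x - u y) ^+ 2 * k y)%:E =
  ((\int[mu]_(y in B) (1 * k y)) * (\int[mu]_(x in A) u x ^+ 2)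
   - 2 * (\int[mu]_(y in B) (u y * k y)) * (\int[mu]_(x in A) u x)
   + (\int[mu]_(y in B) (u y ^+ 2 * k y)) * (\int[mu]_(x in A) 1))%R%:E.
Proof.
move=> mA mB i0 i1 i2 k0 k1 k2.
set K0 := (\int[mu]_(y in B) (1 * k y))%R.
set K1 := (\int[mu]_(y in B) (u y * k y))%R.
set K2 := (\int[mu]_(y in B) (u y ^+ 2 * k y))%R.
have inner x : \int[mu]_(y in B) ((u x - u y) ^+ 2 * k y)%:E =
    (K0 * u x ^+ 2 + (- 2 * K1 * u x + K2 * 1))%R%:E.
  rewrite (eq_integral (fun y => (u x ^+ 2 * (1 * k y) + (- 2 * u x * (u y * k y) +
      1 * (u y ^+ 2 * k y)))%:E)); last by move=> y _; congr EFin; ring.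
  by rewrite integral_lincomb3//; congr EFin; rewrite -/K0 -/K1 -/K2; ring.
under eq_integral do rewrite inner.
by rewrite integral_lincomb3//; congr EFin; ring.
Qed.

(** * The weight *)

Section weight.
Context {R : realType} {d : nat}.
Implicit Types x y : 'rV[R]_d.
Local Open Scope ring_scope.

(** The weight in [mass_approx]; evaluated at [x - y] it is the kernel of
    [Hs_seminorm_sq]. *)
Definition weight (s : R) (y : 'rV[R]_d) : R := (enorm y `^ (d%:R + 2 * s))^-1.

Lemma weight_ge0 s y : 0 <= weight s y.
Proof. by rewrite invr_ge0 powR_ge0. Qed.

Lemma measurable_weight s : measurable_fun setT (weight s).
Proof.
rewrite (_ : weight s = (fun r => r `^ (- (d%:R + 2 * s))) \o enorm).
  by apply: measurableT_comp => //; exact: measurable_enorm.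
by apply/funext => y; rewrite /weight/= powRN.
Qed.

Lemma weight_le1 s y : 0 <= s -> 1 <= enorm y -> weight s y <= 1.
Proof.
move=> s0 y1; rewrite invf_le1 ?powR_gt0 ?(lt_le_trans _ y1)//.
by rewrite -[leLHS](powRr0 (enorm y)) ler_powR// addr_ge0// mulr_ge0.
Qed.

(** On a bounded set the weights increase with [s] up to a constant factor. At the
    origin both sides are [0]. *)
Lemma weight_le s s0 D y : 0 < s <= s0 -> 1 <= D -> enorm y <= D ->
  weight s y <= D `^ (2 * s0) * weight s0 y.
Proof.
move=> /andP[s_gt0 ss0] D1 yD; have s0_gt0 := lt_le_trans s_gt0 ss0.
have a0 t : 0 < t -> d%:R + 2 * t != 0 by move=> t0; rewrite gt_eqF// ltr_wpDl// mulr_gt0.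
have := enorm_ge0 y; rewrite le_eqVlt => /predU1P[y0|y_gt0].
  by rewrite /weight -y0 !powR0 ?a0// invr0 mulr0.
rewrite /weight ler_pdivlMr ?powR_gt0// mulrC ler_pdivrMr ?powR_gt0//.
rewrite (_ : d%:R + 2 * s0 = 2 * (s0 - s) + (d%:R + 2 * s)); last by ring.
rewrite powRD; last by apply/implyP => _; rewrite gt_eqF.
rewrite ler_wpM2r ?powR_ge0//.
have t0 : 0 <= 2 * (s0 - s) by rewrite mulr_ge0// subr_ge0.
apply: (@le_trans _ _ (D `^ (2 * (s0 - s)))).
  by apply: ge0_ler_powR; rewrite // nnegrE ?enorm_ge0// (le_trans ler01 D1).
by apply: ler_powR => //; lra.
Qed.

(** If [|x|] is at most [lam] times [|y|], then [|x - y|] lies between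
    [(1 - lam) |y|] and [(1 + lam) |y|]. *)
Lemma weight_sub_itv lam s x y : 0 < s <= 1 -> 0 < lam < 1 ->
  enorm x <= lam * enorm y -> 0 < enorm y ->
  ((1 + lam) ^+ (d + 2))^-1 * weight s y <= weight s (x - y) <=
  ((1 - lam) ^+ (d + 2))^-1 * weight s y.
Proof.
move=> /andP[s0 s1] /andP[l0 l1] xy y0.
have a0 : 0 <= d%:R + 2 * s by rewrite addr_ge0// mulr_ge0// ltW.
have ad : d%:R + 2 * s <= (d + 2)%:R by rewrite natrD lerD2l; lra.
have l0' : 0 < 1 - lam by rewrite subr_gt0.
have yx := ler_enormD (y - x) x; rewrite subrK in yx.
have xy' := ler_enormD x (- y); rewrite enormN in xy'.
have lo : (1 - lam) * enorm y <= enorm (x - y) by rewrite enorm_distC; nra.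
have hi : enorm (x - y) <= (1 + lam) * enorm y by nra.
have xy_gt0 : 0 < enorm (x - y) by rewrite (lt_le_trans _ lo)// mulr_gt0.
rewrite /weight -!invfM !lef_pV2 ?posrE ?mulr_gt0 ?exprn_gt0 ?powR_gt0 ?l0' ?addr_gt0//.
have l1' : 0 <= 1 + lam by rewrite addr_ge0// ltW.
rewrite -!powR_mulrn// ?(ltW l0')//.
apply/andP; split.
  apply: (@le_trans _ _ (((1 + lam) * enorm y) `^ (d%:R + 2 * s))).
    by apply: ge0_ler_powR; rewrite // nnegrE ?mulr_ge0 ?enorm_ge0.
  rewrite powRM ?enorm_ge0//.
  by apply: ler_wpM2r; [exact: powR_ge0|apply: ler_powR => //; rewrite lerDl ltW].
apply: (@le_trans _ _ (((1 - lam) * enorm y) `^ (d%:R + 2 * s))); last first.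
  by apply: ge0_ler_powR; rewrite // nnegrE ?mulr_ge0 ?enorm_ge0// ltW.
rewrite powRM ?enorm_ge0 ?(ltW l0')//; apply: ler_wpM2r; first exact: powR_ge0.
by apply: ger_powR => //; rewrite l0' gerBl ltW.
Qed.

End weight.

(** * The mass at infinity of a constant *)

Lemma cvg_affine_at_right0 (R : realType) (c k : R) :
  ((1 + s * c) * k)%R @[s --> 0^'+] --> k.
Proof.
apply: cvg_at_right_filter.
have : ((1 + s * c) * k)%R @[s --> (0%R : R)] --> ((1 + 0 * c) * k)%R.
  apply: cvgMr_tmp; apply: cvgD; first exact: cvg_cst.
  by apply: cvgMr_tmp; exact: cvg_id.
by rewrite mul0r addr0 mul1r.
Qed.

(** The two hypotheses on [q] bound [s / (1 - q)] between [1 / b] and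
    [(1 + s b) / b]. *)
Lemma geometric_tail_itv (R : realType) (q Js J b k s : R) :
  (0 < s -> 0 <= k -> J = k * b -> 0 <= q -> q * J <= Js <= J ->
   1 - s * b <= q -> q * (1 + s * b) <= 1 -> 0 < 1 - q ->
   (1 + s * - b) * k <= s * (Js / (1 - q)) <= (1 + s * b) * k)%R.
Proof.
move=> s0 k0 -> q0 /andP[h1 h2] h3 h4 h5.
rewrite [X in (_ <= X <= _)%R]mulrA ler_pdivlMr// ler_pdivrMr//; apply/andP; split.
  apply: (@le_trans _ _ (q * k * (1 - q))%R).
    by apply: (ler_wpM2r (ltW h5)); apply: ler_wpM2r => //; rewrite mulrN.
  apply: (@le_trans _ _ (q * k * (s * b))%R).
    by apply: ler_wpM2l; [exact: mulr_ge0|lra].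
  rewrite (_ : q * k * (s * b) = s * (q * (k * b)))%R; last by ring.
  by apply: ler_wpM2l => //; exact: ltW.
apply: (@le_trans _ _ (s * (k * b))%R).
  by apply: ler_wpM2l => //; exact: ltW.
rewrite (_ : s * (k * b) = k * (s * b))%R; last by ring.
rewrite [leRHS](_ : _ = k * ((1 + s * b) * (1 - q)))%R; last by ring.
by apply: ler_wpM2l => //; lra.
Qed.

Section mass_of_one.
Context {R : realType} {d : nat}.
Local Notation mu := (lebesgue_rV R d).

Let measurable_Eweight s : measurable_fun setT (EFin \o @weight R d s).
Proof. by apply/measurable_EFinP; exact: measurable_weight. Qed.

Let measurable_Eweight_Rd s : measurable_fun setT ((EFin \o @weight R d s) : Rd R d -> \bar R).
Proof. exact: measurable_fun_Rd. Qed.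

Definition dyadic_ratio (s : R) : R := (2 `^ (- (2 * s)))%R.

(** The dilation by [2] divides the weight by [2 ^ (d + 2 s)] and multiplies the
    measure by [2 ^ d]. *)
Lemma integral_weight_scale s (D : set 'rV[R]_d) : measurable D ->
  \int[mu]_(y in D) (weight s y)%:E =
  (dyadic_ratio s)%:E * \int[mu]_(y in ( *:%R 2%R) @^-1` D) (weight s y)%:E.
Proof.
move=> mD.
have mD2 : measurable (( *:%R 2%R) @^-1` D : set (Rd R d)).
  apply: measurable_Rd; rewrite -[X in measurable X]setTI.
  exact: measurable_scale_rV.
have := @ge0_integral_scale_rV R 2 (ltr0Sn R 1) d D (EFin \o weight s) mD.
move=> /(_ (measurable_funTS (measurable_Eweight s))).
move=> /(_ (fun x _ => weight_ge0 s x)) /=.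
have w2 (x : 'rV[R]_d) : weight s (2 *: x)%R = (2 `^ (- (d%:R + 2 * s)) * weight s x)%R.
  by rewrite /weight enormZ// powRM ?enorm_ge0// invfM powRN.
under eq_integral do rewrite w2 EFinM.
rewrite ge0_integralZl//=; last 2 first.
- exact: (measurable_funTS (measurable_Eweight_Rd s)).
- by move=> x _; rewrite lee_fin weight_ge0.
move=> /(congr1 (fun x => (2 ^+ d)%:E * x)).
rewrite !muleA -!EFinM -exprMn divff// expr1n mul1e => <-.
congr (_%:E * _); rewrite /dyadic_ratio opprD powRD; last by apply/implyP.
by rewrite (powRN _ d%:R) powR_mulrn// mulrA divff ?mul1r// expf_neq0.
Qed.

Let annulus n : set 'rV[R]_d := [set y | (1 <= enorm y < 2 ^+ n)%R].

Let measurable_annulus n : measurable (annulus n).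
Proof.
rewrite (_ : annulus n = [set y | (1 <= enorm y)%R] `&` [set y | (enorm y < 2 ^+ n)%R]).
  apply: measurableI; rewrite -[X in measurable X]setTI.
    by apply: measurable_fun_ler => //; exact: measurable_enorm.
  by apply: measurable_fun_ltr => //; exact: measurable_enorm.
by apply/seteqP; split => y /=; [move/andP|move=> ?; exact/andP].
Qed.

Let dyadic_integral s := \int[mu]_(y in annulus 1) (weight s y)%:E.

(** Both bounds are instances of [1 + x <= exp x]. *)
Lemma dyadic_ratio_itv s : (0 < s)%R ->
  (1 - 2 * s * ln 2 <= dyadic_ratio s <= (1 + 2 * s * ln 2)^-1)%R.
Proof.
move=> s0; have ln2 : (0 < ln 2 :> R)%R by rewrite ln_gt0// ltr1n.
have a0 : (0 <= 2 * s * ln 2)%R by rewrite !mulr_ge0// ltW.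
have -> : dyadic_ratio s = expR (- (2 * s * ln 2)).
  by rewrite /dyadic_ratio /powR pnatr_eq0/= mulNr.
rewrite (le_trans _ (expR_ge1Dx _))//= expRN lef_pV2 ?posrE ?expR_gt0 ?expR_ge1Dx//.
by rewrite ltr_wpDr.
Qed.

Lemma dyadic_integral_lty s : (0 <= s)%R -> dyadic_integral s < +oo.
Proof.
move=> s0; apply: (@le_lt_trans _ _ (\int[mu]_(y in annulus 1) 1)).
  apply: ge0_le_integral.
  - exact: measurable_Rd.
  - by move=> y _; rewrite lee_fin weight_ge0.
  - exact: (measurable_funTS (measurable_Eweight_Rd s)).
  - exact: measurable_cst.
  - by move=> y /= /andP[y1 _]; rewrite lee_fin weight_le1.
rewrite integral_cst ?mul1e//; last exact: measurable_Rd.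
apply: le_lt_trans (lebesgue_rV_ball_lty (d := d) (ler0n R 2)).
apply: le_measure; rewrite ?inE; first exact: measurable_Rd.
  exact: measurable_enorm_le.
by move=> y /= /andP[_]; rewrite expr1 => /ltW.
Qed.

(** On [1 <= |y| < 2] the weights for [s] and for [0] differ by the factor
    [|y| ^ - (2 s)], which lies between [dyadic_ratio s] and [1]. *)
Lemma dyadic_integral_itv s : (0 <= s)%R ->
  (dyadic_ratio s)%:E * dyadic_integral 0 <= dyadic_integral s <= dyadic_integral 0.
Proof.
move=> s0; rewrite -ge0_integralZl//=; last 4 first.
- exact: measurable_Rd.
- exact: (measurable_funTS (measurable_Eweight_Rd 0)).
- by move=> y _; rewrite lee_fin weight_ge0.
- by rewrite lee_fin powR_ge0.
have wE (y : 'rV[R]_d) : (1 <= enorm y)%R ->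
    (weight s y = enorm y `^ (- (2 * s)) * weight 0 y)%R.
  move=> y1; rewrite /weight mulr0 addr0 powRD ?invfM ?powRN 1?mulrC//.
  by apply/implyP => _; rewrite gt_eqF// (lt_le_trans _ y1).
apply/andP; split; apply: ge0_le_integral.
- exact: measurable_Rd.
- by move=> y _; rewrite mule_ge0 ?lee_fin ?powR_ge0 ?weight_ge0.
- by apply: measurable_funeM; exact: (measurable_funTS (measurable_Eweight_Rd 0)).
- exact: (measurable_funTS (measurable_Eweight_Rd s)).
- move=> y /= /andP[y1 y2]; rewrite lee_fin wE// ler_wpM2r ?weight_ge0//.
  rewrite /dyadic_ratio !powRN lef_pV2 ?posrE ?powR_gt0 ?(lt_le_trans _ y1)//.
  by rewrite ge0_ler_powR ?nnegrE ?mulr_ge0 ?enorm_ge0 ?ler0n//; exact: ltW.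
- exact: measurable_Rd.
- by move=> y _; rewrite lee_fin weight_ge0.
- exact: (measurable_funTS (measurable_Eweight_Rd s)).
- exact: (measurable_funTS (measurable_Eweight_Rd 0)).
- move=> y /= /andP[y1 y2]; rewrite lee_fin wE// ler_piMl ?weight_ge0//.
  by rewrite -[leRHS](powRr0 (enorm y)) ler_powR// oppr_le0 mulr_ge0.
Qed.

(** The map [y |-> 2 y] turns [1 <= |y|] into [2 <= |y|], so the integral [I] over
    the former set satisfies [I = J + q I], where [J] is the integral over
    [1 <= |y| < 2] and [q < 1]. The same equation for the truncations
    [1 <= |y| < 2 ^ n] shows that they stay below [J / (1 - q)], hence that [I]
    is finite. *)
Lemma integral_weight s : (0 < s)%R ->
  \int[mu]_(y in [set y | (1 <= enorm y)%R]) (weight s y)%:E =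
  (fine (dyadic_integral s) / (1 - dyadic_ratio s))%:E.
Proof.
move=> s0.
set J := dyadic_integral s; set q := dyadic_ratio s.
have J0 : 0 <= J by apply: integral_ge0 => y _; rewrite lee_fin weight_ge0.
have Jfin : J \is a fin_num by rewrite ge0_fin_numE// dyadic_integral_lty// ltW.
have q0 : (0 <= q)%R by exact: powR_ge0.
have q1 : (q < 1)%R.
  have [_ /le_lt_trans->//] := andP (dyadic_ratio_itv s0).
  by rewrite invf_lt1 ?ltrDl ?addr_gt0 ?mulr_gt0 ?ln_gt0 ?ltr1n.
have q1' : (1 - q != 0)%R by rewrite gt_eqF// subr_gt0.
pose tail : set 'rV[R]_d := [set y | (1 <= enorm y)%R].
have mtail : measurable tail.
  rewrite -[X in measurable X]setTI.
  by apply: measurable_fun_ler => //; exact: measurable_enorm.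
have splitJ (D : set 'rV[R]_d) : measurable D -> D `<=` tail ->
    \int[mu]_(y in annulus 1 `|` (fun y => D (2^-1 *: y)%R)) (weight s y)%:E =
    J + q%:E * \int[mu]_(y in D) (weight s y)%:E.
  move=> mD Dtail.
  have mD2 : measurable (fun y : 'rV[R]_d => D (2^-1 *: y)%R).
    by rewrite -[X in measurable X]setTI; exact: measurable_scale_rV.
  rewrite ge0_integral_setU//=; last 5 first.
  - exact: measurable_Rd.
  - exact: measurable_Rd.
  - exact: (measurable_funTS (measurable_Eweight_Rd s)).
  - by move=> y _; rewrite lee_fin weight_ge0.
  - apply/disj_setPRL => y /= Dy /andP[_]; apply/negP; rewrite -leNgt expr1.
    have := Dtail _ Dy; rewrite /tail/= enormZ// ler_pdivlMl//.
    by rewrite mulr1.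
  congr (_ + _); rewrite (integral_weight_scale s mD2); congr (_ * _).
  by apply: congr2 => //; apply/funext => y /=; rewrite scalerA mulVf// scale1r.
have tailE : tail = annulus 1 `|` (fun y => tail (2^-1 *: y)%R).
  apply/seteqP; split => y; rewrite /tail /annulus/= enormZ//.
    by move=> y1; case: (ltP (enorm y) 2%R) => y2; [left; apply/andP|right; lra].
  by move=> [/andP[]//|]; lra.
have annulusE n : annulus n.+1 = annulus 1 `|` (fun y => annulus n (2^-1 *: y)%R).
  have two_pow : (1 <= 2 ^+ n :> R)%R by rewrite exprn_ege1// ler1n.
  apply/seteqP; split => y; rewrite /annulus/= enormZ// expr1 exprS.
    move=> /andP[y1 yn]; case: (ltP (enorm y) 2%R) => y2; [left|right];
      by apply/andP; split => //; lra.
  by move=> [/andP[y1 y2]|/andP[y1 y2]]; apply/andP; split; lra.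
have annulus_le n :
    \int[mu]_(y in annulus n) (weight s y)%:E <= (fine J / (1 - q))%:E.
  elim: n => [|n IH].
    rewrite (_ : annulus 0 = set0) ?integral_set0.
      by rewrite lee_fin divr_ge0 ?fine_ge0 ?subr_ge0// ltW.
    by rewrite -subset0 => y /= /andP[/le_lt_trans/[apply]]; rewrite ltxx.
  rewrite annulusE splitJ//; last by move=> y /andP[].
  rewrite -{1}(fineK Jfin).
  apply: (@le_trans _ _ ((fine J)%:E + q%:E * (fine J / (1 - q))%:E)).
    by apply: leeD2l; apply: lee_wpmul2l => //; rewrite lee_fin.
  rewrite -EFinM -EFinD lee_fin [leRHS](_ : _ = fine J + q * (fine J / (1 - q)))%R//.
  by field.
have tail_fin : \int[mu]_(y in tail) (weight s y)%:E \is a fin_num.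
  rewrite ge0_fin_numE; last by apply: integral_ge0 => y _; rewrite lee_fin weight_ge0.
  have -> : tail = \bigcup_n annulus n.
    apply/seteqP; split => [y y1|y [n _] /= /andP[]//].
    have [n yn] : exists n, (enorm y < 2 ^+ n)%R.
      exists (Num.bound (enorm y)); rewrite (lt_trans (archi_boundP (enorm_ge0 y)))//.
      by rewrite -natrX ltr_nat ltn_expl.
    by exists n => //; apply/andP.
  apply: (@le_lt_trans _ _ (fine J / (1 - q))%:E); last exact: ltry.
  pose A : (set (Rd R d))^nat := annulus.
  have nd : nondecreasing_seq A.
    apply/nondecreasing_seqP => n; apply/subsetPset => y /= /andP[y1 yn].
    by apply/andP; split => //; rewrite (lt_le_trans yn)// ler_eXn2l ?ltr1n.
  have Icvg := @ge0_nondecreasing_set_cvg_integral _ _ _ A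
    (EFin \o weight s) mu nd (fun n => measurable_Rd (measurable_annulus n))
    (fun n => measurable_funTS (measurable_Eweight_Rd s))
    (fun n y _ => weight_ge0 s y).
  rewrite -(cvg_lim _ Icvg)//; apply: lime_le; first by apply/cvg_ex; eexists; exact: Icvg.
  by near=> n; exact: annulus_le.
have := splitJ tail mtail (@subset_refl _ _).
rewrite -tailE -(fineK tail_fin) -(fineK Jfin) -EFinM -EFinD => -[IE].
congr EFin; apply: (mulIf q1'); rewrite divfK// mulrBr mulr1 {1}IE; ring.
Unshelve. all: by end_near. Qed.

(** By [integral_weight] the quantity is [s / (1 - q)] times an integral that tends
    to its value for [s = 0], with [q = dyadic_ratio s]. The two bounds on [q] make
    the first factor tend to [1 / (2 ln 2)]. *)
Lemma cvg_mass_approx1 :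
  mass_approx (fun _ : 'rV[R]_d => 1%R) s @[s --> 0^'+] -->
  (fine (dyadic_integral 0) / (2 * ln 2))%:E.
Proof.
have J_ge0 s : 0 <= dyadic_integral s.
  by apply: integral_ge0 => y _; rewrite lee_fin weight_ge0.
have J_fin s : (0 <= s)%R -> dyadic_integral s \is a fin_num.
  by move=> s0; rewrite ge0_fin_numE// dyadic_integral_lty.
set J := fine (dyadic_integral 0).
have b0 : (0 < 2 * ln 2 :> R)%R by rewrite mulr_gt0// ln_gt0// ltr1n.
set b := (2 * ln 2)%R in b0 *.
pose q := dyadic_ratio.
apply: (@cvg_trans _ ((s * (fine (dyadic_integral s) / (1 - q s)))%:E @[s --> 0^'+])).
  apply: near_eq_cvg; near=> s; have s0 : (0 < s)%R by [].
  rewrite /mass_approx EFinM; congr (_ * _); rewrite -integral_weight//.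
  by apply: eq_integral => y _; rewrite /weight div1r.
apply: cvg_EFin; first by near=> s.
rewrite /=.
apply: (@squeeze_cvgr _ _ _ _ (fun s : R => (1 + s * - b) * (J / b))%R
  (fun s : R => (1 + s * b) * (J / b))%R); [|exact: cvg_affine_at_right0..].
near=> s; have s0 : (0 < s)%R by [].
have := dyadic_ratio_itv s0; have -> : (2 * s * ln 2 = s * b)%R by rewrite /b; ring.
have := dyadic_integral_itv (ltW s0).
rewrite -(fineK (J_fin _ (ltW s0))) -(fineK (J_fin _ (lexx 0%R))) -EFinM !lee_fin.
rewrite -/J -/(q s) => JsJ /andP[q1 q2].
have sb0 : (0 < s * b)%R by rewrite mulr_gt0.
have q_ge0 : (0 <= q s)%R by exact: powR_ge0.
have q2' : (q s * (1 + s * b) <= 1)%R.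
  by rewrite -ler_pdivlMr ?div1r// ltr_wpDl// ltW.
apply: (geometric_tail_itv s0 _ _ q_ge0 JsJ) => //.
- by rewrite divr_ge0 ?fine_ge0// ltW.
- by rewrite divfK// gt_eqF.
- by nra.
Unshelve. all: by end_near. Qed.

End mass_of_one.

(** * Masses at infinity *)

Section mass_at_infinity.
Context {R : realType} {d : nat}.
Local Notation mu := (lebesgue_rV R d).
Implicit Types (w : 'rV[R]_d -> R) (M a s : R).

Definition outer M : set (Rd R d) := [set y | (M <= enorm y)%R].

Lemma measurable_outer M : measurable (outer M).
Proof. exact: measurable_enorm_ge. Qed.

Let measurable_weight_Rd s : measurable_fun setT (weight s : Rd R d -> R).
Proof. by apply: measurable_fun_Rd; exact: measurable_weight. Qed.

Definition outer_integral M w s : R := (\int[mu]_(y in outer M) (w y * weight s y))%R.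

(** A form of the statement that the mass of [w] is [a] in which [w] may change
    sign and the radius of the removed ball is arbitrary. *)
Definition has_mass M w a :=
  (\forall s \near 0^'+, mu.-integrable (outer M) (EFin \o (fun y => w y * weight s y)%R)) /\
  (s * outer_integral M w s)%R @[s --> 0^'+] --> a.

Lemma cvg_mass_approx w a : has_mass 1 w a -> mass_approx w s @[s --> 0^'+] --> a%:E.
Proof.
move=> [wint wa].
apply: (@cvg_trans _ ((s * outer_integral 1 w s)%:E @[s --> 0^'+]));
  last by apply: cvg_EFin; [exact: nearW|exact: wa].
apply: near_eq_cvg; near=> s; rewrite /= /mass_approx EFinM; congr (_ * _).
rewrite /Rintegral fineK//; apply: integrable_fin_num; first exact: measurable_outer.
by near: s.
Unshelve. all: by end_near. Qed.

Lemma alpha_has_mass w a : has_mass 1 w a -> alpha w = a%:E.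
Proof. by move=> /cvg_mass_approx wa; exact: cvg_lim wa. Qed.

(** A finite limit forces the integrals to be finite for small [s], and for a
    nonnegative function that is integrability. *)
Lemma ge0_has_mass w a : lebesgue_measurable_fun setT w -> (forall y, 0 <= w y)%R ->
  mass_approx w s @[s --> 0^'+] --> a%:E -> has_mass 1 w a.
Proof.
move=> mw w0 /fine_cvgP[wfin wa].
have wint : \forall s \near 0^'+,
    mu.-integrable (outer 1) (EFin \o (fun y => w y * weight s y)%R).
  near=> s; have s0 : (0 < s)%R by [].
  apply/integrableP; split.
    apply/measurable_EFinP; apply: measurable_funTS; apply: measurable_funM.
      exact: mw.
    exact: measurable_weight_Rd.
  rewrite (eq_integral (fun y : Rd R d => (w y * weight s y)%:E)); last first.
    by move=> y _; rewrite /= ger0_norm// mulr_ge0// weight_ge0.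
  have : mass_approx w s \is a fin_num by near: s.
  rewrite /mass_approx; set I := (X in _ * X).
  have I0 : 0 <= I by apply: integral_ge0 => y _; rewrite lee_fin mulr_ge0// weight_ge0.
  rewrite -[X in X < _]/I; case: I I0 => [r _ _|_|]//; first exact: ltry.
  by rewrite gt0_muley// lte_fin.
split => //; apply: cvg_trans wa; apply: near_eq_cvg; near=> s.
rewrite /= /mass_approx fineM//=.
by apply: integrable_fin_num; [exact: measurable_outer|near: s].
Unshelve. all: by end_near. Qed.

Lemma has_massB M w1 w2 a1 a2 : has_mass M w1 a1 -> has_mass M w2 a2 ->
  has_mass M (fun y => w1 y - w2 y)%R (a1 - a2)%R.
Proof.
move=> [i1 c1] [i2 c2]; split.
  near=> s; have j1 : mu.-integrable (outer M) (EFin \o (fun y => w1 y * weight s y)%R).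
    by near: s.
  have j2 : mu.-integrable (outer M) (EFin \o (fun y => w2 y * weight s y)%R).
    by near: s.
  rewrite (_ : _ \o _ = (EFin \o (fun y => w1 y * weight s y)%R) \-
    (EFin \o (fun y => w2 y * weight s y)%R)).
    by apply: integrableB => //; exact: measurable_outer.
  by apply/funext => y /=; rewrite mulrBl.
apply: cvg_trans (cvgB c1 c2); apply: near_eq_cvg; near=> s => /=.
rewrite /outer_integral [X in _ = (_ * X)%R](_ : _ = \int[mu]_(y in outer M)
    (w1 y * weight s y - w2 y * weight s y))%R; last first.
  by apply: eq_Rintegral => y _; rewrite mulrBl.
rewrite RintegralB; first by rewrite mulrBr.
- exact: measurable_outer.
- by near: s.
- by near: s.
Unshelve. all: by end_near. Qed.

(** Between radii [1] and [M] the weight is at most [1], so the factor [s] kills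
    the corresponding integral in the limit. *)
Lemma has_mass_outer M w a : (1 <= M)%R ->
  mu.-integrable [set y | (enorm y <= M)%R] (EFin \o w) ->
  has_mass 1 w a -> has_mass M w a.
Proof.
move=> M1 wM [i1 c1].
have M_sub : outer M `<=` outer 1 by move=> y; exact: le_trans.
have iM : \forall s \near 0^'+,
    mu.-integrable (outer M) (EFin \o (fun y => w y * weight s y)%R).
  near=> s; apply: integrableS M_sub _; try exact: measurable_outer.
  by near: s.
split => //.
pose B := outer 1 `\` outer M.
have mB : measurable B by apply: measurableD; exact: measurable_outer.
have BM : B `<=` [set y | (enorm y <= M)%R].
  by move=> y [_] /negP; rewrite -ltNge => /ltW.
pose C := (\int[mu]_(y in B) `|w y|)%R.
pose g s := (s * \int[mu]_(y in B) (w y * weight s y))%R.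
have g0 : g s @[s --> 0^'+] --> (0 : R)%R.
  apply/cvgr0Pnorm_lt => e e0.
  have C0 : (0 <= C)%R by apply: Rintegral_ge0.
  have Ce : (0 < e / (C + 1))%R by rewrite divr_gt0// ltr_wpDl.
  near=> s; have s0 : (0 < s)%R by [].
  have Bint : mu.-integrable B (EFin \o (fun y => w y * weight s y)%R).
    apply: integrableS (@subDsetl _ _ _) _; [exact: measurable_outer|exact: mB|].
    by near: s.
  have wB : mu.-integrable B (EFin \o w).
    by apply: integrableS BM wM; [exact: measurable_enorm_le|exact: mB].
  rewrite /g normrM gtr0_norm//.
  apply: (@le_lt_trans _ _ (s * C)%R).
    apply: ler_wpM2l; first exact: ltW.
    apply: (le_trans (le_normr_Rintegral mB Bint)).
    apply: le_Rintegral; [exact: mB|exact: (integrable_norm Bint)|exact: (integrable_norm wB)|].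
    move=> y [y1 _].
      rewrite normrM ler_piMr// ger0_norm ?weight_ge0// weight_le1//; exact: ltW.
  apply: (@le_lt_trans _ _ (s * (C + 1))%R); first by rewrite ler_wpM2l ?lerDl// ltW.
  by rewrite -ltr_pdivlMr ?ltr_wpDl//; near: s; exact: (nbhs_right_lt Ce).
rewrite -[a]subr0; apply: cvg_trans (cvgB c1 g0); apply: near_eq_cvg; near=> s => /=.
have i1s : mu.-integrable (outer 1) (EFin \o (fun y => w y * weight s y)%R) by near: s.
have BE : B `|` outer M = outer 1 by rewrite setUC setDUK.
have E : (\int[mu]_(y in outer 1) (w y * weight s y) =
    \int[mu]_(y in B) (w y * weight s y) +
    \int[mu]_(y in outer M) (w y * weight s y))%R.
  rewrite -BE Rintegral_setU.
  - by [].
  - exact: mB.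
  - exact: measurable_outer.
  - by rewrite BE.
  - by apply/disj_setPRL => y /= My [_]; apply.
transitivity (s * outer_integral 1 w s - g s)%R; first by [].
by rewrite /outer_integral E /g mulrDr addrAC subrr add0r.
Unshelve. all: by end_near. Qed.

End mass_at_infinity.

(** * Near pairs and far pairs *)

Section decomposition.
Context {R : realType} {d : nat}.
Local Notation mu := (lebesgue_rV R d).
Variables (Om : set (Rd R d)) (u : Rd R d -> R) (rho : R).
Hypotheses (mOm : measurable Om) (mfu : measurable_fun setT u).
Hypothesis Om_rho : forall x, Om x -> (enorm x <= rho)%R.

Let F s (p : Rd R d * Rd R d) : \bar R :=
  (`|u p.1 - u p.2| ^+ 2 * weight s (p.1 - p.2))%:E.

Let F_ge0 s p : 0 <= F s p.
Proof. by rewrite lee_fin mulr_ge0 ?sqr_ge0 ?weight_ge0. Qed.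

Let measurable_square :
  measurable_fun setT (fun p : Rd R d * Rd R d => `|u p.1 - u p.2| ^+ 2)%R.
Proof.
apply: measurable_funX; apply: measurableT_comp; first exact: normr_measurable.
exact: (measurable_funB (measurableT_comp mfu measurable_fst)
  (measurableT_comp mfu measurable_snd)).
Qed.

Let measurable_F s : measurable_fun setT (F s).
Proof.
apply/measurable_EFinP; apply: measurable_funM; first exact: measurable_square.
rewrite (_ : (fun _ => _) = (fun r => r `^ (- (d%:R + 2 * s)))%R \o
  (fun p : Rd R d * Rd R d => enorm (p.1 - p.2)%R)).
  by apply: measurableT_comp; [exact: measurable_powR|exact: measurable_enorm_dist].
by apply/funext => p; rewrite /weight/= powRN.
Qed.

Definition near_pairs M : set (Rd R d * Rd R d) :=
  Qset Om `\` (Om `*` outer M `|` outer M `*` Om).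

Let measurable_Qset : measurable (Qset Om).
Proof. by apply: measurableC; apply: measurableX; exact: (measurableC mOm). Qed.

Let measurable_near_pairs M : measurable (near_pairs M).
Proof.
apply: measurableD; first exact: measurable_Qset.
by apply: measurableU; apply: measurableX => //; exact: measurable_outer.
Qed.

(** By symmetry the two rectangles contribute equally. *)
Lemma seminorm_split M s : (rho < M)%R ->
  Hs_seminorm_sq s Om u = \int[mu \x mu]_(p in near_pairs M) F s p +
    2%:E * \int[mu]_(x in Om) \int[mu]_(y in outer M) F s (x, y).
Proof.
move=> rhoM.
have Om_outer x : Om x -> outer M x -> False.
  by move=> /Om_rho xrho /(lt_le_trans rhoM) /lt_le_trans/(_ xrho); rewrite ltxx.
have mO := @measurable_outer R d M.
have mF1 : measurable (Om `*` outer M) := measurableX mOm mO.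
have mF2 : measurable (outer M `*` Om) := measurableX mO mOm.
have QE : Qset Om = near_pairs M `|` (Om `*` outer M `|` outer M `*` Om).
  rewrite /near_pairs setUC setDUK// => -[x y] /= [[Ox My]|[Mx Oy]] [Ox' Oy'] => //.
have -> : Hs_seminorm_sq s Om u = \int[mu \x mu]_(p in Qset Om) F s p by [].
rewrite QE ge0_integral_setU; last 5 first.
- exact: measurable_near_pairs.
- exact: measurableU.
- exact: measurable_funTS.
- by [].
- by apply/disj_setPRL => p Fp [_]; apply.
congr (_ + _); rewrite ge0_integral_setU; last 5 first.
- exact: mF1.
- exact: mF2.
- exact: measurable_funTS.
- by [].
- by apply/disj_setPRL => -[x y] [/= Mx Oy] [/= Ox _]; exact: Om_outer Ox Mx.
rewrite (ge0_integral_setX_sym mu mOm mO (measurable_F s) (F_ge0 s)); last first.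
  by move=> x y; rewrite /F/= /weight distrC enorm_distC.
rewrite -(ge0_integral_setX mu mu mOm mO (measurable_F s) (F_ge0 s)).
by rewrite -mule2n mule_natl.
Qed.

(** In a near pair both points have norm at most [M], so [weight_le] applies at
    distance [2 M]. The bound does not depend on [s]: multiplied by [s] it tends to
    [0]. *)
Lemma near_pairs_le M s s0 : (1 <= M)%R -> (rho < M)%R -> (0 < s <= s0)%R ->
  \int[mu \x mu]_(p in near_pairs M) F s p <=
  ((2 * M) `^ (2 * s0))%:E * Hs_seminorm_sq s0 Om u.
Proof.
move=> M1 rhoM ss0.
have -> : Hs_seminorm_sq s0 Om u = \int[mu \x mu]_(p in Qset Om) F s0 p by [].
apply: (@le_trans _ _ (\int[mu \x mu]_(p in near_pairs M)
    (((2 * M) `^ (2 * s0))%:E * F s0 p))).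
  apply: ge0_le_integral.
  - exact: measurable_near_pairs.
  - by [].
  - exact: measurable_funTS.
  - by apply: measurable_funeM; exact: measurable_funTS.
  move=> [x y] [/= Qxy nF]; rewrite -EFinM lee_fin mulrCA.
  apply: ler_wpM2l; first exact: sqr_ge0.
  apply: weight_le => //; first lra.
  have [xM yM] : (enorm x <= M)%R /\ (enorm y <= M)%R.
    have [Ox|nOx] := pselect (Om x).
      split; first exact: le_trans (Om_rho Ox) (ltW rhoM).
      by have [//|/ltW My] := leP (enorm y) M; case: nF; left.
    have Oy : Om y by apply: contrapT => nOy; exact: Qxy.
    split; last exact: le_trans (Om_rho Oy) (ltW rhoM).
    by have [//|/ltW Mx] := leP (enorm x) M; case: nF; right.
  by rewrite (le_trans (ler_enormD _ _))// enormN; lra.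
rewrite ge0_integralZl; last 4 first.
- exact: measurable_near_pairs.
- exact: (measurable_funTS (measurable_F s0)).
- by [].
- by rewrite lee_fin powR_ge0.
apply: lee_wpmul2l; first by rewrite lee_fin powR_ge0.
apply: ge0_subset_integral.
- exact: measurable_near_pairs.
- exact: measurable_Qset.
- exact: measurable_funTS.
- by [].
- by move=> p [].
Qed.

Definition weighted_square M s : \bar R :=
  \int[mu]_(x in Om) \int[mu]_(y in outer M) ((u x - u y) ^+ 2 * weight s y)%:E.

Lemma far_pairs_itv lam M s : (0 < lam < 1)%R -> (0 < M)%R -> (rho <= lam * M)%R ->
  (0 < s <= 1)%R ->
  (((1 + lam) ^+ (d + 2))^-1)%:E * weighted_square M s <=
    \int[mu]_(x in Om) \int[mu]_(y in outer M) F s (x, y) <=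
  (((1 - lam) ^+ (d + 2))^-1)%:E * weighted_square M s.
Proof.
move=> lam01 M0 rhoM s01.
have mO := @measurable_outer R d M.
have mF1 : measurable (Om `*` outer M) := measurableX mOm mO.
pose H (p : Rd R d * Rd R d) : \bar R := (`|u p.1 - u p.2| ^+ 2 * weight s p.2)%:E.
have H0 p : 0 <= H p by rewrite lee_fin mulr_ge0 ?sqr_ge0 ?weight_ge0.
have mH : measurable_fun setT H.
  apply/measurable_EFinP; apply: measurable_funM; first exact: measurable_square.
  have mw := measurable_fun_Rd (@measurable_weight R d s).
  exact: (measurableT_comp mw measurable_snd).
have -> : weighted_square M s = \int[mu \x mu]_(p in Om `*` outer M) H p.
  rewrite (ge0_integral_setX mu mu mOm mO mH H0); apply: eq_integral => x _.
  by apply: eq_integral => y _; rewrite /H/= real_normK ?num_real.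
rewrite -(ge0_integral_setX mu mu mOm mO (measurable_F s) (F_ge0 s)).
have [l0 l1] := andP lam01.
have c0 t : (-1 < t)%R -> 0 <= (((1 + t) ^+ (d + 2))^-1)%:E :> \bar R.
  by move=> t1; rewrite lee_fin invr_ge0 exprn_ge0//; lra.
have mHO := measurable_funTS mH : measurable_fun (Om `*` outer M) H.
have mFO := measurable_funTS (measurable_F s) : measurable_fun (Om `*` outer M) (F s).
have FH x y : Om x -> outer M y ->
    (((1 + lam) ^+ (d + 2))^-1 * weight s y <= weight s (x - y) <=
    ((1 - lam) ^+ (d + 2))^-1 * weight s y)%R.
  move=> Ox My; apply: weight_sub_itv => //; last exact: lt_le_trans My.
  apply: le_trans (Om_rho Ox) (le_trans rhoM _).
  by apply: ler_wpM2l => //; exact: ltW.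
rewrite -!ge0_integralZl; do ?[exact: mF1|exact: mHO|by []|by apply: c0; lra].
apply/andP; split; apply: ge0_le_integral.
- exact: mF1.
- by move=> p _; rewrite mule_ge0// c0//; lra.
- exact: (measurable_funeM _ mHO).
- exact: mFO.
- move=> [x y] [Ox My]; rewrite -EFinM lee_fin mulrCA.
  by apply: ler_wpM2l; [exact: sqr_ge0|have /andP[] := FH x y Ox My].
- exact: mF1.
- by [].
- exact: mFO.
- exact: (measurable_funeM _ mHO).
- move=> [x y] [Ox My]; rewrite -EFinM lee_fin mulrCA.
  by apply: ler_wpM2l; [exact: sqr_ge0|have /andP[] := FH x y Ox My].
Qed.

End decomposition.

(** * Squeezing up to a factor *)

(** The bounds need only squeeze [T] up to a factor that tends to [1] when the
    auxiliary parameter [lam] tends to [0] after [s]. *)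
Lemma squeeze_cvge_factor (R : realType) (n : nat) (T : R -> \bar R) (L : R) :
  (forall lam, (0 < lam < 1)%R -> exists C (g : R -> R),
    g s @[s --> 0^'+] --> L /\
    \forall s \near 0^'+, (((1 + lam) ^+ n)^-1 * g s)%:E <= T s <=
                          (s * C + ((1 - lam) ^+ n)^-1 * g s)%:E) ->
  T s @[s --> 0^'+] --> L%:E.
Proof.
move=> H.
have factor_cvg (c : R) : (((1 + t * c) ^+ n)^-1 * L)%R @[t --> 0^'+] --> L.
  have lin1 : (1 + t * c)%R @[t --> 0^'+] --> (1 : R)%R.
    by under eq_fun do rewrite -[(1 + _)%R]mulr1; exact: cvg_affine_at_right0.
  have pow1 : ((1 + t * c) ^+ n)%R @[t --> 0^'+] --> (1 ^+ n : R)%R.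
    exact: (@continuous_cvg _ _ _ _ _ _ (fun x : R => x ^+ n)%R _ (@exprn_continuous R n 1%R) lin1).
  rewrite expr1n in pow1.
  have inv1 := @cvgMr_tmp _ _ _ _ _ _ L (cvgV (oner_neq0 R) pow1).
  by rewrite invr1 mul1r in inv1; exact: inv1.
have bounds e : (0 < e)%R -> \forall s \near 0^'+, (L - e)%:E <= T s <= (L + e)%:E.
  move=> e0; have e2 : (0 < e / 2)%R by rewrite divr_gt0.
  have [lam [lam01 lo hi]] : exists lam : R, [/\ (0 < lam < 1)%R,
      (L - e / 2 < ((1 + lam) ^+ n)^-1 * L)%R & (((1 - lam) ^+ n)^-1 * L < L + e / 2)%R].
    (* small enough for both factors to move [L] by less than half of [e] *)
    apply: (@filter_ex _ (0^'+ : set_system R)); near=> t; split.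
    - by apply/andP; split=> //; near: t; exact: nbhs_right_lt.
    - rewrite -[t in ltRHS]mulr1; near: t.
      by apply: cvgr_gt (factor_cvg _) _ _; rewrite ltrBlDr ltrDl.
    - rewrite -[(- t)%R]mulrN1; near: t.
      by apply: cvgr_lt (factor_cvg _) _ _; rewrite ltrDl.
  have [C [g [gL gT]]] := H _ lam01.
  have g_lo : (((1 + lam) ^+ n)^-1 * g s)%R @[s --> 0^'+] --> (((1 + lam) ^+ n)^-1 * L)%R.
    exact: cvgMl_tmp.
  have g_hi : (s * C + ((1 - lam) ^+ n)^-1 * g s)%R @[s --> 0^'+] -->
      (0 * C + ((1 - lam) ^+ n)^-1 * L)%R.
    apply: cvgD; last exact: cvgMl_tmp.
    by apply: cvgMr_tmp; apply: cvg_at_right_filter; exact: cvg_id.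
  rewrite mul0r add0r in g_hi.
  near=> s; have /andP[T1 T2] : (((1 + lam) ^+ n)^-1 * g s)%:E <= T s <=
    (s * C + ((1 - lam) ^+ n)^-1 * g s)%:E by near: s.
  apply/andP; split; [apply: le_trans T1|apply: (le_trans T2)]; rewrite lee_fin ltW//.
    near: s; apply: cvgr_gt g_lo _ _; apply: lt_trans lo; lra.
  by near: s; apply: cvgr_lt g_hi _ _; apply: lt_trans hi _; lra.
apply/fine_cvgP; split.
  near=> s; have /andP[T1 T2] : (L - 1)%:E <= T s <= (L + 1)%:E.
    by near: s; exact: bounds.
  by rewrite fin_real// (lt_le_trans (ltNyr _) T1)/= (le_lt_trans T2 (ltry _)).
apply/cvgrPdist_le => e e0; near=> s.
have : (L - e)%:E <= T s <= (L + e)%:E by near: s; exact: bounds.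
rewrite /=; case: (T s) => [r| |]; [|by case/andP|by case/andP].
by rewrite !lee_fin => /andP[r1 r2]; rewrite /= ler_norml; apply/andP; split; lra.
Unshelve. all: by end_near. Qed.

(** * The masses of the powers of the function *)

Lemma integrable_one d (T : measurableType d) (R : realType)
    (mu : {measure set T -> \bar R}) (D : set T) :
  measurable D -> mu D < +oo -> mu.-integrable D (EFin \o cst 1%R).
Proof.
move=> mD Dfin; apply/integrableP; split.
  by apply/measurable_EFinP; exact: measurable_cst.
rewrite (eq_integral (cst 1)) ?integral_cst ?mul1e// => x _ /=.
by congr EFin; rewrite normr1.
Qed.

(** On a set of finite measure, [|u| <= 1 + u ^ 2] makes [u] integrable. *)
Lemma integrable_L2 d (T : measurableType d) (R : realType)
    (mu : {measure set T -> \bar R}) (D : set T) (u : T -> R) :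
  measurable D -> mu D < +oo -> measurable_fun D u ->
  \int[mu]_(x in D) (`|u x| ^+ 2)%:E < +oo ->
  [/\ mu.-integrable D (EFin \o cst 1%R), mu.-integrable D (EFin \o u) &
      mu.-integrable D (EFin \o (fun x => u x ^+ 2)%R)].
Proof.
move=> mD Dfin mfu u2.
have mu2 : measurable_fun D (EFin \o (fun x => u x ^+ 2)%R).
  by apply/measurable_EFinP; exact: measurable_funX.
have i0 := integrable_one mD Dfin.
have i2 : mu.-integrable D (EFin \o (fun x => u x ^+ 2)%R).
  apply/integrableP; split => //; apply: le_lt_trans u2.
  rewrite le_eqVlt; apply/orP; left; apply/eqP.
  by apply: eq_integral => x _; rewrite /= normrX.
split => //; apply: le_integrable (integrableD mD i0 i2) => //.
  exact/measurable_EFinP.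
move=> x Dx /=; rewrite lee_fin [leRHS]ger0_norm ?addr_ge0 ?sqr_ge0//.
rewrite -(real_normK (num_real (u x))).
have := normr_ge0 (u x); have := sqr_ge0 (`|u x| - 1)%R; rewrite sqrrB expr1n /=.
lra.
Qed.

(** The ball lies in a cube, which is compact. *)
Lemma L2loc_ball (R : realType) (d : nat) (u : 'rV[R]_d -> R) (r : R) : L2loc u ->
  \int[lebesgue_rV R d]_(x in [set y | (enorm y <= r)%R]) (`|u x| ^+ 2)%:E < +oo.
Proof.
move=> [mfu u2K].
pose K : set 'rV[R]_d := [set v | forall i, `[(- r)%R, r]%classic (v ord0 i)].
have cK : compact K.
  apply: (@rV_compact _ _ (fun=> `[(- r)%R, r]%classic)) => _.
  exact: segment_compact.
have [mKu] := u2K K cK; apply: le_lt_trans; apply: ge0_subset_integral.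
- exact: measurable_enorm_le.
- rewrite (_ : K = \big[setI/setT]_(i < d) (rV_coord i @^-1` `[(- r)%R, r])).
    apply: measurable_Rd; apply: bigsetI_measurable => i _.
    by rewrite -[X in measurable X]setTI; exact: measurable_rV_coord.
  rewrite -bigcap_seq; apply/seteqP; split => v Kv i; first by move=> _; exact: Kv.
  exact: (Kv i (mem_index_enum _)).
- apply/measurable_EFinP; apply: measurable_funX.
  exact: (measurableT_comp (@normr_measurable R setT)).
- by move=> y _; rewrite lee_fin sqr_ge0.
- move=> y yr i; rewrite /= in_itv/= -ler_norml.
  exact: le_trans (ler_coord_enorm y i) yr.
Qed.

Lemma bounded_set_enorm (R : realType) (d : nat) (Om : set 'rV[R]_d) : bounded_set Om ->
  exists2 rho : R, (1 <= rho)%R & forall x, Om x -> (enorm x <= rho)%R.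
Proof.
move=> [M [_ OmM]]; exists (Num.max 1 (d%:R * (M + 1)))%R; first by rewrite le_max lexx.
move=> x Ox; rewrite le_max; apply/orP; right.
apply: le_trans (ler_enorm_norm x) _; apply: ler_wpM2l; first exact: ler0n.
by apply: OmM Ox; rewrite ltrDl.
Qed.

Lemma alpha_exists_finite_cvg (R : realType) (d : nat) (w : 'rV[R]_d -> R) :
  alpha_exists_finite w -> mass_approx w s @[s --> 0^'+] --> (fine (alpha w))%:E.
Proof. by move=> [cw aw]; rewrite fineK. Qed.

Lemma has_mass1 (R : realType) (d : nat) (M : R) : (1 <= M)%R ->
  has_mass M (fun _ : 'rV[R]_d => 1%R) (fine (alpha (fun _ : 'rV[R]_d => 1%R))).
Proof.
move=> M1.
have mcst : lebesgue_measurable_fun setT (fun _ : 'rV[R]_d => 1%R : R).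
  exact: measurable_cst.
have one := ge0_has_mass mcst (fun=> ler01) (@cvg_mass_approx1 R d).
rewrite (alpha_has_mass one); apply: has_mass_outer => //.
apply: integrable_one; first exact: measurable_enorm_le.
exact: lebesgue_rV_ball_lty (le_trans ler01 M1).
Qed.

Section powers.
Context {R : realType} {d : nat}.
Local Notation mu := (lebesgue_rV R d).
Variable u : 'rV[R]_d -> R.
Hypothesis u_loc : L2loc u.

Let mfu : measurable_fun setT (u : Rd R d -> R) := u_loc.1.

Lemma integrable_ball r : (0 <= r)%R ->
  mu.-integrable [set y | (enorm y <= r)%R] (EFin \o u) /\
  mu.-integrable [set y | (enorm y <= r)%R] (EFin \o (fun x => u x ^+ 2)%R).
Proof.
move=> r0.
have [] // := @integrable_L2 _ _ _ mu [set y | (enorm y <= r)%R] u.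
- exact: measurable_enorm_le.
- exact: lebesgue_rV_ball_lty.
- exact: (measurable_funTS mfu).
- exact: L2loc_ball.
Qed.

Lemma has_mass_id M : (1 <= M)%R ->
  alpha_exists_finite u^\+%R -> alpha_exists_finite u^\-%R ->
  has_mass M u (fine (alpha u)).
Proof.
move=> M1 up un.
have uE : u = (fun y => u^\+ y - u^\- y)%R.
  by apply/esym; exact: funrposBneg.
have u1 : has_mass 1 u (fine (alpha u^\+%R) - fine (alpha u^\-%R)).
  rewrite {1}uE; apply: has_massB; apply: ge0_has_mass.
  - exact: measurable_funrpos.
  - exact: funrpos_ge0.
  - exact: alpha_exists_finite_cvg.
  - exact: measurable_funrneg.
  - exact: funrneg_ge0.
  - exact: alpha_exists_finite_cvg.
rewrite (alpha_has_mass u1); apply: has_mass_outer => //.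
by have [] := integrable_ball (le_trans ler01 M1).
Qed.

Lemma has_mass_sqr M : (1 <= M)%R -> alpha_exists_finite (fun x => u x ^+ 2)%R ->
  has_mass M (fun y => u y ^+ 2)%R (fine (alpha (fun y => u y ^+ 2)%R)).
Proof.
move=> M1 u2; apply: has_mass_outer => //.
  by have [] := integrable_ball (le_trans ler01 M1).
apply: ge0_has_mass; last exact: alpha_exists_finite_cvg u2.
- exact: measurable_funX.
- by move=> y; rewrite sqr_ge0.
Qed.

End powers.

(** * The limit of the seminorms *)

Lemma sum_binomial2 (R : realType) (A0 A1 A2 U0 U1 U2 : R) :
  ('C(2, 0)%:R * (-1) ^+ 0)%:E * A0%:E * U2%:E +
  ('C(2, 1)%:R * (-1) ^+ 1)%:E * A1%:E * U1%:E +
  ('C(2, 2)%:R * (-1) ^+ 2)%:E * A2%:E * U0%:E =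
  (A0 * U2 - 2 * A1 * U1 + A2 * U0)%R%:E.
Proof. by rewrite bin0 bin1 binn -!EFinM -!EFinD; congr EFin; ring. Qed.

(** The summand [N] stands for the near pairs and [P] for each of the two
    rectangles. *)
Lemma half_sum_itv (R : realType) (s a b g : R) (N P W B : \bar R) : (0 < s)%R ->
  0 <= N -> 0 <= P -> N <= B -> B < +oo -> a%:E * W <= P <= b%:E * W ->
  s%:E * W = g%:E ->
  (a * g)%:E <= (s / 2)%:E * (N + 2%:E * P) <= (s * (fine B / 2) + b * g)%:E.
Proof.
move=> s0 N0 P0 NB Bfin /andP[aP Pb] sW.
have [w wE] : exists w, W = w%:E.
  case: W sW {aP Pb} => [w _|/eqP|/eqP]; first by exists w.
    by rewrite gt0_muley.
  by rewrite gt0_muleNy.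
move: sW aP Pb; rewrite wE -!EFinM => -[<-] aP Pb.
have [p pE] : exists p, P = p%:E.
  by exists (fine P); rewrite fineK// ge0_fin_numE// (le_lt_trans Pb)// ltry.
have [n nE] : exists n, N = n%:E.
  by exists (fine N); rewrite fineK// ge0_fin_numE// (le_lt_trans NB).
have [c cE] : exists c, B = c%:E.
  by exists (fine B); rewrite fineK// ge0_fin_numE// (le_trans N0).
move: N0 P0 NB aP Pb; rewrite pE nE cE.
rewrite -[(s / 2)%:E * _]/((s / 2 * (n + 2 * p))%R%:E) !lee_fin /=.
move=> n0 p0 nc ap pb.
have sn : (0 <= s * n)%R by rewrite mulr_ge0// ltW.
have snc : (s * n <= s * c)%R by rewrite ler_pM2l.
have sap : (s * (a * w) <= s * p)%R by rewrite ler_pM2l.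
have spb : (s * p <= s * (b * w))%R by rewrite ler_pM2l.
by apply/andP; split; lra.
Qed.

Section seminorm_limit.
Context {R : realType} {d : nat}.
Local Notation mu := (lebesgue_rV R d).
Variables (Om : set (Rd R d)) (u : Rd R d -> R) (rho s0 a0 a1 a2 : R).
Hypotheses (mOm : measurable Om) (mfu : measurable_fun setT u).
Hypotheses (rho1 : (1 <= rho)%R) (Om_rho : forall x, Om x -> (enorm x <= rho)%R).
Hypotheses (s0_gt0 : (0 < s0)%R) (Hs0 : Hs_seminorm_sq s0 Om u < +oo).
Hypotheses (i0 : mu.-integrable Om (EFin \o cst 1%R)) (i1 : mu.-integrable Om (EFin \o u))
  (i2 : mu.-integrable Om (EFin \o (fun x => u x ^+ 2)%R)).
Hypotheses (m0 : forall M, (1 <= M)%R -> has_mass M (fun _ : 'rV[R]_d => 1%R) a0)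
  (m1 : forall M, (1 <= M)%R -> has_mass M u a1)
  (m2 : forall M, (1 <= M)%R -> has_mass M (fun x => u x ^+ 2)%R a2).

Lemma cvg_weighted_square M : (1 <= M)%R ->
  exists2 g : R -> R,
    g s @[s --> 0^'+] --> (a0 * \int[mu]_(x in Om) (u x ^+ 2)
      - 2 * a1 * \int[mu]_(x in Om) u x + a2 * \int[mu]_(x in Om) 1)%R &
    \forall s \near 0^'+, s%:E * weighted_square Om u M s = (g s)%:E.
Proof.
move=> M1; have [j0 c0] := m0 M1; have [j1 c1] := m1 M1; have [j2 c2] := m2 M1.
exists (fun s => s * outer_integral M (fun _ : 'rV[R]_d => 1) s * \int[mu]_(x in Om) (u x ^+ 2)
  - 2 * (s * outer_integral M u s) * \int[mu]_(x in Om) u x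
  + s * outer_integral M (fun x => u x ^+ 2) s * \int[mu]_(x in Om) 1)%R.
  apply: cvgD; last exact: cvgMr_tmp.
  apply: cvgB; first exact: cvgMr_tmp.
  by apply: cvgMr_tmp; exact: cvgMl_tmp.
near=> s; rewrite /weighted_square.
rewrite (integral_square_diff mOm (measurable_outer M) i0 i1 i2); first last.
- by near: s.
- by near: s.
- by near: s.
rewrite -EFinM /outer_integral; congr EFin.
move: (Rintegral _ _ _) (Rintegral _ _ _) (Rintegral _ _ _)
  (Rintegral _ _ _) (Rintegral _ _ _) (Rintegral _ _ _) => x1 x2 x3 x4 x5 x6.
ring.
Unshelve. all: by end_near. Qed.

(** The radius [rho / lam] is chosen so that [|x| <= lam * |y|] for [x] in [Om] and
    [|y|] beyond it. *)
Lemma cvg_seminorm :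
  (s / 2)%:E * Hs_seminorm_sq s Om u @[s --> 0^'+] -->
  (a0 * \int[mu]_(x in Om) (u x ^+ 2) - 2 * a1 * \int[mu]_(x in Om) u x
    + a2 * \int[mu]_(x in Om) 1)%R%:E.
Proof.
have rho0 : (0 < rho)%R by exact: lt_le_trans rho1.
apply: (@squeeze_cvge_factor R (d + 2)) => lam lam01.
have [lam0 lam1] := andP lam01.
(* [M > rho], so the two rectangles of far pairs are disjoint *)
pose M : R := (rho / lam)%R.
have rhoM : (rho < M)%R by rewrite ltr_pdivlMr// gtr_pMr.
have M1 : (1 <= M)%R by exact: le_trans rho1 (ltW rhoM).
have rho_lam : (rho <= lam * M)%R by rewrite mulrC divfK// gt_eqF.
have [g gL gE] := cvg_weighted_square M1.
pose B := ((2 * M) `^ (2 * s0))%:E * Hs_seminorm_sq s0 Om u.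
exists (fine B / 2)%R, g; split => //; near=> s.
have s_gt0 : (0 < s)%R by [].
have s_le : (0 < s <= s0)%R by rewrite s_gt0/=; near: s; exact: nbhs_right_le.
have s_le1 : (0 < s <= 1)%R by rewrite s_gt0/=; near: s; exact: nbhs_right_le.
rewrite (seminorm_split mOm mfu Om_rho s rhoM).
have := near_pairs_le mOm mfu Om_rho M1 rhoM s_le; rewrite -/B.
have := far_pairs_itv mOm mfu Om_rho lam01 (lt_trans rho0 rhoM) rho_lam s_le1.
have gEs : s%:E * weighted_square Om u M s = (g s)%:E by near: s.
set W := weighted_square Om u M s in gEs *.
set P := \int[mu]_(x in Om) _; set N := \int[mu \x mu]_(p in _) _.
have N0 : 0 <= N.
  by apply: integral_ge0 => p _; rewrite lee_fin mulr_ge0 ?sqr_ge0 ?weight_ge0.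
have P0 : 0 <= P.
  apply: integral_ge0 => x _; apply: integral_ge0 => y _.
  by rewrite lee_fin mulr_ge0 ?sqr_ge0 ?weight_ge0.
have Bfin : B < +oo by rewrite lte_mul_pinfty// lee_fin powR_ge0.
by move=> PW NB; exact: (half_sum_itv s_gt0 N0 P0 NB Bfin PW gEs).
Unshelve. all: by end_near. Qed.

End seminorm_limit.

Theorem theorem1p3 (R : realType) (d : nat) (d_gt0 : (0 < d)%N)
    (Om : set 'rV[R]_d) (u : 'rV[R]_d -> R) :
  bounded_lipschitz_domain Om ->
  L2loc u ->
  (exists s0 : R, (0 < s0 < 1)%R /\ Hs s0 Om u) ->
  alpha_exists_finite (u^\+)%R ->
  alpha_exists_finite (u^\-)%R ->
  alpha_exists_finite (fun x => u x ^+ 2)%R ->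
  (s / 2)%:E * Hs_seminorm_sq s Om u @[s --> 0^'+] -->
    \sum_(0 <= k < 3) ('C(2, k)%:R * (-1) ^+ k)%:E * alpha (fun x => u x ^+ k)%R *
      \int[lebesgue_rV R d]_(x in Om) (u x ^+ (2 - k))%:E.
Proof.
move=> [[_ oOm _] bOm _] u_loc [s0 [/andP[s0_gt0 s0_lt1] [mfu [_ uOm] Hs0]]] up un u2.
have mOm : measurable (Om : set (Rd R d)).
  by apply: measurable_Rd; exact: open_measurable_rV.
have [rho rho1 Om_rho] := bounded_set_enorm bOm.
have rho0 : (0 < rho)%R by exact: lt_le_trans rho1.
have Om_fin : lebesgue_rV R d Om < +oo.
  apply: le_lt_trans (lebesgue_rV_ball_lty (d := d) (ltW rho0)).
  apply: le_measure; rewrite ?inE; [exact: mOm| |exact: Om_rho].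
  exact: measurable_enorm_le.
have [i0 i1 i2] := integrable_L2 mOm Om_fin (measurable_funTS mfu) uOm.
have := cvg_seminorm mOm mfu rho1 Om_rho s0_gt0 Hs0 i0 i1 i2
  (fun M => @has_mass1 R d M) (fun M M1 => has_mass_id u_loc M1 up un)
  (fun M M1 => has_mass_sqr u_loc M1 u2).
congr (_ --> _).
have a0 : alpha (fun x => u x ^+ 0)%R = (fine (alpha (fun _ : 'rV[R]_d => 1%R)))%:E.
  exact: (alpha_has_mass (has_mass1 d (lexx 1%R))).
have a1 : alpha (fun x => u x ^+ 1)%R = (fine (alpha u))%:E.
  exact: (alpha_has_mass (has_mass_id u_loc (lexx 1%R) up un)).
have a2 := alpha_has_mass (has_mass_sqr u_loc (lexx 1%R) u2).
have RintE (w : 'rV[R]_d -> R) : (lebesgue_rV R d).-integrable Om (EFin \o w) ->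
    \int[lebesgue_rV R d]_(x in Om) (w x)%:E = (\int[lebesgue_rV R d]_(x in Om) w x)%R%:E.
  by move=> wi; rewrite fineK//; exact: (integrable_fin_num mOm wi).
rewrite !big_nat_recr//= big_geq// add0e a0 a1 a2.
rewrite (RintE (fun x => u x ^+ 2)%R)// (RintE u)// (RintE (fun=> 1%R))//.
by apply/esym; exact: sum_binomial2.
Qed.
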